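(* Let $(E,d)$ be a Polish space whose distance $d$ is bounded by $1$, and let $P$ be a Markov kernel on $(E,\mathcal{B}(E))$. Assume that there exist a coupling kernel $Q$ for $P$, a set $\Delta\in\mathcal{B}(E\times E)$, an integer $\ell\ge1$, $\epsilon>0$, a function $\phi\in\mathbb{F}$ and a measurable function $V:E\to[1,\infty)$ such that: (a) $Qd(x,y)\le d(x,y)$ for every $x,y\in E$, and $Q^{\ell}d(x,y)\le(1-\epsilon)d(x,y)$ for every $(x,y)\in\Delta$; (b) there exists a constant $b<\infty$ such that for all $x,y\in E$, $$PV(x)+PV(y)\le V(x)+V(y)-\phi(V(x)+V(y))+b\,\mathbf{1}_{\Delta}(x,y),$$ and $\sup_{(x,y)\in\Delta}\{V(x)+V(y)\}<+\infty$. Then $P$ admits a unique invariant probability measure $\pi$, and $\int_E\phi\circ V(x)\,\pi(dx)<\infty$.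
   Context: A coupling kernel for a Markov kernel $P$ on $(E,\mathcal{B}(E))$ is a Markov kernel $Q$ on $(E\times E,\mathcal{B}(E\times E))$ such that for every $x,y\in E$ the probability $Q((x,y),\cdot)$ has first marginal $P(x,\cdot)$ and second marginal $P(y,\cdot)$. For a kernel $K$ and a nonnegative measurable function $f$, $Kf(x)=\int f(z)\,K(x,dz)$, and $K^n$ is the $n$-th iterate of $K$. $\mathbb{F}$ is the set of concave increasing functions $\phi:\mathbb{R}_+\to\mathbb{R}_+$ that are continuously differentiable on $[1,+\infty)$ and satisfy $\lim_{x\to+\infty}\phi(x)=+\infty$ and $\lim_{x\to+\infty}\phi'(x)=0$. *)

(* Defs.v *)
From HB Require Import structures.
From mathcomp Require Import all_boot all_order all_algebra.
From mathcomp Require Import all_classical all_reals all_analysis.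

Set Implicit Arguments.
Unset Strict Implicit.
Unset Printing Implicit Defensive.

Import Order.TTheory GRing.Theory Num.Theory.
Import numFieldNormedType.Exports.

Local Open Scope classical_set_scope.
Local Open Scope ring_scope.

(* Complete metric spaces, with distance [mdist]; [Complete] includes
   [Pointed], so these spaces are nonempty. *)
#[short(type="completeMetricType")]
HB.structure Definition CompleteMetric (R : numDomainType) :=
  {T of Metric R T & Complete T}.

Definition separable (T : topologicalType) : Prop :=
  exists2 S : set T, countable S & dense S.

(* [borel (E * E)] carries the sigma-algebra generated by the open sets of the
   product topology, not the product sigma-algebra of [borel E * borel E]. *)
Notation borel T := (g_sigma_algebraType (@open T)).

Section kernels.
Context d (T : measurableType d) (R : realType).
Local Open Scope ereal_scope.

Definition kernel_apply (K : T -> {measure set T -> \bar R}) (f : T -> \bar R)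
  (x : T) : \bar R := \int[K x]_z f z.

(* The library equips [mkcomp_noparam] only with the subprobability kernel
   structure, hence the return type. *)
Fixpoint kernel_iter (K : R.-pker T ~> T) (n : nat) : R.-spker T ~> T :=
  if n is m.+1 then mkcomp_noparam K (kernel_iter K m)
  else kdirac (@measurable_id _ T setT).

Definition invariant_probability (K : R.-pker T ~> T) (pi : probability T R)
  : Prop :=
  forall A : set T, measurable A -> \int[pi]_x K x A = pi A.

End kernels.

Definition coupling_kernel (R : realType) (E : completeMetricType R)
    (P : R.-pker (borel E) ~> (borel E))
    (Q : R.-pker (borel (E * E)%type) ~> (borel (E * E)%type)) : Prop :=
  forall (x y : E) (A : set (borel E)), measurable A ->
    Q (x, y) (fst @^-1` A) = P x A /\ Q (x, y) (snd @^-1` A) = P y A.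

(* [g] is the continuous derivative of [f] on [1, +oo[; it is one-sided at 1. *)
Definition C1_derivative_from1 (R : realType) (f g : R -> R) : Prop :=
  (forall x : R, 1 <= x ->
    (f y - f x) / (y - x) @[y --> within `[1, +oo[%classic x^'] --> g x) /\
  {within `[1, +oo[, continuous g}.

(* Functions on R_+ are given by functions on R whose values on negative
   arguments are irrelevant. *)
Definition subgeometric_rate_class (R : realType) (phi : R -> R) : Prop :=
  [/\ (forall x : R, 0 <= x -> 0 <= phi x),
      convex_function (`[0, +oo[%classic : set R) (fun x => - phi x),
      {in `[0, +oo[ &, {homo phi : x y / x <= y}},
      phi x @[x --> +oo] --> +oo &
      exists2 dphi : R -> R, C1_derivative_from1 phi dphi &
        dphi x @[x --> +oo] --> (0 : R)].

(* Main.v *)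
Require Import Defs.
From HB Require Import structures.
From mathcomp Require Import all_boot all_order all_algebra.
From mathcomp Require Import all_classical all_reals all_analysis.
From mathcomp Require Import measurable_realfun ring lra.

(** Write W(x, y) = V(x) + V(y), so that W >= 2 and c = phi(2) > 0 by concavity.

    Coupling. The drift condition gives Q W <= W - c off Delta, so the coupled
    chain started at (x, y) visits Delta repeatedly, and the probability of few
    visits before time n is of order W(x, y) / n. The mean distance never
    increases and loses a factor 1 - eps over l steps from Delta. Hence
    Q^n d(x, y) <= (1 - eps)^m + K_m W(x, y) / n ([drift_contraction]), and
    Q^n d tends to 0 uniformly where W is bounded. For a 1-Lipschitz f this
    bounds P^n f(x) - P^n f(y) ([iter_lip]).

    Existence. On the diagonal the drift condition bounds the averages of
    P^k (phi o V)(x0) over k ([foster_sum_le]). Through the coupling this compares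
    the chain at times n and n + k, so that the laws P^n(x0, .) are Cauchy
    uniformly over 1-Lipschitz functions ([law_cauchy]). Such a sequence
    converges weakly ([weak_completeness]): it is tight because E is complete and
    separable ([uniformly_tight]), and the limit functional on Lipschitz functions
    is an integral, by a Daniell construction through an outer measure
    ([daniell]). Since P preserves Lipschitz functions, the limit is invariant
    ([law_limit_invariant]).

    Uniqueness follows from the coupling and dominated convergence
    ([law_limit_unique]), and integrability of phi o V from truncating the drift
    inequality at level n ([foster_invariant]). *)

Set Implicit Arguments.
Unset Strict Implicit.
Unset Printing Implicit Defensive.

Import Order.TTheory GRing.Theory Num.Theory.
Import numFieldNormedType.Exports.

Local Open Scope classical_set_scope.
Local Open Scope ring_scope.

(** * Integration against kernels *)

Section kernel_integral.
Context d (T : measurableType d) (R : realType).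
Local Open Scope ereal_scope.
Implicit Types (f : T -> \bar R) (K : R.-pker T ~> T).

Lemma kernel_apply_ge0 (K : T -> {measure set T -> \bar R}) f :
  (forall x, 0 <= f x) -> forall x, 0 <= kernel_apply K f x.
Proof. by move=> f0 x; apply: integral_ge0. Qed.

Lemma measurable_kernel_apply K f :
  (forall x, 0 <= f x) -> measurable_fun setT f ->
  measurable_fun setT (kernel_apply K f).
Proof.
move=> f0 mf; apply: measurable_fun_integral_kernel => // U mU.
exact: measurable_kernel.
Qed.

Lemma kernel_apply_iter K n f x :
  (forall x, 0 <= f x) -> measurable_fun setT f ->
  kernel_apply (kernel_iter K n) f x = iter n (kernel_apply K) f x.
Proof.
move=> f0 mf; elim: n x => [|n IHn] x.
  rewrite /kernel_apply /=/kdirac.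
  by rewrite integral_dirac// diracT mul1e.
rewrite /kernel_apply [kernel_iter _ _]/=.
rewrite (_ : \int[_]_z _ =
  \int[kcomp K (kernel.kernel_snd (kernel_iter K n)) x]_z f z)//.
rewrite integral_kcomp//=.
by apply: eq_integral => y _; rewrite -IHn.
Qed.

(** The image of pi by K is the composition of K with the constant kernel pi,
    which reduces the change of variables to that for composed kernels. *)
Lemma kernel_image_measure K (pi : probability T R) :
  exists m : {measure set T -> \bar R},
    (forall A, measurable A -> m A = \int[pi]_x K x A) /\
    forall f, (forall x, 0 <= f x) -> measurable_fun setT f ->
      \int[m]_x f x = \int[pi]_x kernel_apply K f x.
Proof.
pose l := kprobability
  (measurable_cst (pi : pprobability T R) : measurable_fun [set: T] _).
exists (kcomp l (kernel.kernel_snd K) point); split => // f f0 mf.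
exact: (@integral_kcomp _ _ _ T T T R l (kernel.kernel_snd K) point f f0 mf).
Qed.

Lemma invariant_integral K (pi : probability T R) f :
  invariant_probability K pi ->
  (forall x, 0 <= f x) -> measurable_fun setT f ->
  \int[pi]_x kernel_apply K f x = \int[pi]_x f x.
Proof.
move=> Kpi f0 mf; have [m [mE mI]] := kernel_image_measure K pi.
by rewrite -mI//; apply: eq_measure_integral => A mA _; rewrite mE// Kpi.
Qed.

End kernel_integral.

(** * Nonnegative Lipschitz functions *)

Section nonneg_lipschitz.
Context (R : realType) (E : completeMetricType R).
Hypothesis dist_le1 : forall x y : E, mdist x y <= 1.
Implicit Types f g : E -> R.

Definition lip_with (C : R) f := forall x y, f x <= f y + C * mdist x y.

(** The test functions. As the distance is at most 1 they are bounded, hence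
    stable under products; restricting to nonnegative ones keeps every
    integral in the domain where additivity is unconditional. *)
Definition nlip f := (forall x, 0 <= f x) /\ exists2 C, 0 <= C & lip_with C f.

Lemma nlip_bounded f : nlip f -> exists2 B, 0 < B & forall x, f x <= B.
Proof.
move=> [f0 [C C0 fC]]; exists (f point + C + 1) => [|x].
  by rewrite ltr_pwDr// addr_ge0.
apply: le_trans (fC x point) _; rewrite -addrA lerD2l.
by rewrite (@le_trans _ _ C) ?lerDl// ler_piMr.
Qed.

Lemma nlip_cst c : 0 <= c -> nlip (fun=> c).
Proof. by move=> c0; split => //; exists 0 => // x y; rewrite mul0r addr0. Qed.

Lemma nlipD f g : nlip f -> nlip g -> nlip (fun x => f x + g x).
Proof.
move=> [f0 [C C0 fC]] [g0 [D D0 gD]]; split=> [x|]; first exact: addr_ge0.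
exists (C + D) => [|x y]; first exact: addr_ge0.
by rewrite mulrDl addrACA lerD.
Qed.

Lemma nlipZ c f : 0 <= c -> nlip f -> nlip (fun x => c * f x).
Proof.
move=> c0 [f0 [C C0 fC]]; split=> [x|]; first exact: mulr_ge0.
exists (c * C) => [|x y]; first exact: mulr_ge0.
by rewrite -mulrA -mulrDr ler_wpM2l.
Qed.

Lemma nlip_min f g : nlip f -> nlip g -> nlip (fun x => Num.min (f x) (g x)).
Proof.
move=> [f0 [C C0 fC]] [g0 [D D0 gD]]; split=> [x|].
  by rewrite le_min f0 g0.
exists (C + D) => [|x y]; first exact: addr_ge0.
have Cd := mulr_ge0 C0 (mdist_ge0 x y); have Dd := mulr_ge0 D0 (mdist_ge0 x y).
have := fC x y; have := gD x y.
by rewrite !minElt; case: ltP => ?; case: ltP => ?; lra.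
Qed.

Lemma nlipB f g : nlip f -> nlip g -> (forall x, g x <= f x) ->
  nlip (fun x => f x - g x).
Proof.
move=> [f0 [C C0 fC]] [g0 [D D0 gD]] gf; split=> [x|]; first by rewrite subr_ge0.
exists (C + D) => [|x y]; first exact: addr_ge0.
have := fC x y; have := gD y x; rewrite (metric_sym y x); lra.
Qed.

Lemma nlipM f g : nlip f -> nlip g -> nlip (fun x => f x * g x).
Proof.
move=> nf ng; have [B B0 fB] := nlip_bounded nf.
have [B' B'0 gB] := nlip_bounded ng.
move: nf ng => [f0 [C C0 fC]] [g0 [D D0 gD]]; split=> [x|]; first exact: mulr_ge0.
exists (C * B' + B * D) => [|x y]; first by rewrite addr_ge0// mulr_ge0// ltW.
(* f x g x - f y g y = (f x - f y) g x + f y (g x - g y). *)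
have h1 : f x * g x <= (f y + C * mdist x y) * g x by rewrite ler_wpM2r.
have h2 : f y * g x <= f y * (g y + D * mdist x y) by rewrite ler_wpM2l.
have h3 : C * mdist x y * g x <= C * mdist x y * B'.
  by rewrite ler_wpM2l// mulr_ge0// mdist_ge0.
have h4 : f y * (D * mdist x y) <= B * (D * mdist x y).
  by rewrite ler_wpM2r// mulr_ge0// mdist_ge0.
lra.
Qed.

Lemma lip_open_gt C f r : 0 <= C -> lip_with C f -> open [set x | r < f x].
Proof.
move=> C0 fC; rewrite openE => x /= rfx.
apply/nbhs_ballP; exists ((f x - r) / (C + 1)) => [|y] /=.
  by rewrite divr_gt0 ?subr_gt0// ltr_wpDl.
have C1 : 0 < C + 1 by rewrite ltr_wpDl.
rewrite ballEmdist/= ltr_pdivlMr// => xy.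
have := fC x y; have := mdist_ge0 x y; lra.
Qed.

Lemma nlip_open_gt f r : nlip f -> open [set x | r < f x].
Proof. by case=> _ [C]; exact: lip_open_gt. Qed.

Lemma nlip_closed_le f r : nlip f -> closed [set x | f x <= r].
Proof.
move=> nf; rewrite -openC (_ : ~` _ = [set x | r < f x]); first exact: nlip_open_gt.
by apply/seteqP; split=> x /=; [move/negP; rewrite -ltNge|rewrite leNgt => ->].
Qed.

Lemma nlip_dist y : nlip (fun x => mdist y x).
Proof.
split=> [x|]; first exact: mdist_ge0.
exists 1 => // x z; rewrite mul1r (metric_sym x z); exact: metric_triangle.
Qed.

End nonneg_lipschitz.

Lemma measurable_fun_generator (R : realType) (T : pointedType)
    (G : set (set T)) (f : T -> R) :
  (forall r, G [set x | r < f x]) ->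
  measurable_fun [set: g_sigma_algebraType G] (f : g_sigma_algebraType G -> R).
Proof.
move=> Gf; apply: (measurability _ (RGenOInfty.measurableE R)).
move=> _ /= [_ [r ->] <-]; rewrite setTI; apply: sub_sigma_algebra => /=.
by rewrite preimage_itvoy; exact: Gf.
Qed.

Lemma measurable_nlip (R : realType) (E : completeMetricType R) (f : E -> R) :
  nlip f -> measurable_fun [set: borel E] (f : borel E -> R).
Proof. by move=> nf; apply: measurable_fun_generator => r; exact: nlip_open_gt. Qed.

(** * Borel sets generated by Lipschitz functions *)

Section borel_generation.
Context (R : realType) (E : completeMetricType R).
Hypothesis E_separable : separable E.

Lemma dense_sequence :
  exists s : nat -> E, forall x r, 0 < r -> exists n, mdist (s n) x < r.
Proof.
have [S cS dS] := E_separable.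
have /pfcard_geP[S0|[s]] := cS.
  by have [x []] := dS setT (ex_intro _ point I) openT; rewrite S0.
exists s => x r r0.
have [||y [xy Sy]] := dS [set y | 0 < r - mdist x y].
- by exists x; rewrite /= mdistxx subr0.
- apply: (@lip_open_gt _ _ 1) => // y z.
  have := metric_triangle x y z; rewrite mul1r; lra.
have [n _ sn] := 'surj_s Sy.
by exists n; rewrite sn metric_sym -subr_gt0.
Qed.

(** These sets form a pi-system containing the balls; by separability they
    generate the Borel sets. *)
Definition positive_sets := [set A : set E | exists2 f, nlip f & A = [set x | 0 < f x]].

Lemma positive_sets_setI : setI_closed positive_sets.
Proof.
move=> _ _ [f nf ->] [g ng ->].
exists (fun x => Num.min (f x) (g x)); first exact: nlip_min.
by apply/seteqP; split => x /=; rewrite lt_min; [move=> [-> ->]|move=> /andP].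
Qed.

Lemma positive_setsT : positive_sets setT.
Proof.
exists (fun=> 1); first exact: nlip_cst.
by apply/seteqP; split => x _ //=.
Qed.

Lemma positive_sets_ball x r : positive_sets [set y | mdist x y < r].
Proof.
have [r0|r0] := leP r 0.
  exists (fun=> 0); first exact: nlip_cst.
  apply/seteqP; split => y /=; last by rewrite ltxx.
  by rewrite ltNge (le_trans r0)// mdist_ge0.
exists (fun y => r - Num.min r (mdist x y)).
  apply: nlipB; [exact/nlip_cst/ltW| |by move=> y; rewrite ge_min lexx].
  by apply: nlip_min; [exact/nlip_cst/ltW|exact: nlip_dist].
by apply/seteqP; split => y /=; rewrite subr_gt0 gt_min ltxx.
Qed.

Lemma measurable_positive_sets :
  (measurable : set (set (borel E))) = <<s positive_sets >>.
Proof.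
apply/seteqP; split; apply: smallest_sub.
- exact: smallest_sigma_algebra.
- move=> O oO; have [s ds] := dense_sequence.
  have -> : O = \bigcup_n \bigcup_k (if `[< [set y | mdist (s n) y < k.+1%:R^-1] `<=` O >]
      then [set y | mdist (s n) y < k.+1%:R^-1] else set0).
    apply/seteqP; split => [x Ox|x [n _ [k _]]]; last first.
      by case: asboolP => // kO; exact: kO.
    move: oO; rewrite openE => /(_ x Ox) /nbhs_ballP[e /= e0].
    rewrite ballEmdist => eO.
    (* Radius below e / 2: a ball through x centred at a point of the dense
       sequence then stays within distance e of x. *)
    pose k := Num.truncn (2 / e).
    have ke : 2 * k.+1%:R^-1 < e.
      rewrite -ltr_pdivlMl// -[ltRHS]invrK ltf_pV2 ?posrE// ?invr_gt0 ?mulr_gt0//.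
      by rewrite invfM invrK; exact: truncnS_gt.
    have [n snx] := ds x k.+1%:R^-1 (ltac:(by rewrite invr_gt0)).
    exists n => //; exists k => //; case: asboolP => //; case.
    move=> y /= sny; apply: eO => /=.
    have := metric_triangle x (s n) y; rewrite (metric_sym x (s n)) => /le_lt_trans; apply.
    by apply: lt_trans ke; rewrite mulr_natl mulr2n ltrD.
  have sP := smallest_sigma_algebra setT positive_sets.
  have [P0 _ Pcup] := sP.
  apply: (Pcup) => n; apply: (Pcup) => k; case: ifP => _; last exact: P0.
  by apply: sub_sigma_algebra; exact: positive_sets_ball.
- exact: smallest_sigma_algebra.
- move=> _ [f nf ->]; apply: sub_sigma_algebra; exact: nlip_open_gt.
Qed.

Lemma measure_le_integral (m : {measure set (borel E) -> \bar R}) A (g : E -> R) :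
  measurable (A : set (borel E)) -> nlip g -> (forall x, A x -> 1 <= g x) ->
  (m A <= \int[m]_x (g x)%:E)%E.
Proof.
move=> mA ng Ag; rewrite -[X in (m X <= _)%E]setIT -integral_indic//.
apply: ge0_le_integral => //.
- by apply/measurable_EFinP; exact: measurable_indic.
- by apply/measurable_EFinP; exact: measurable_nlip.
- move=> x _; rewrite lee_fin indicE; case: (boolP (x \in A)) => [|_].
    by rewrite inE => /Ag.
  by have [] := ng.
Qed.

(** The indicator of {f > 0} is the increasing limit of min(1, k f), so the
    two measures agree on a generating pi-system. *)
Lemma measure_eq_nlip (m1 m2 : {measure set (borel E) -> \bar R}) :
  (m1 setT < +oo)%E ->
  (forall f, nlip f -> (forall x, f x <= 1) ->
    (\int[m1]_x (f x)%:E = \int[m2]_x (f x)%:E)%E) ->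
  forall A, measurable A -> m1 A = m2 A.
Proof.
move=> m1oo m12; apply: (@measure_unique _ R (borel E) positive_sets (fun=> setT)) => //.
- exact: measurable_positive_sets.
- exact: positive_sets_setI.
- by move=> _; exact: positive_setsT.
- by apply/seteqP; split => // x _; exists 0%N.
move=> _ [f nf ->].
have mf (r : R) : measurable ([set x | r < f x] : set (borel E)).
  by apply: sub_sigma_algebra; exact: nlip_open_gt.
have f0 x : 0 <= f x by have [] := nf.
pose s (k : nat) x := Num.min 1 (k.+1%:R * f x).
have ns k : nlip (s k) by apply: nlip_min; [exact: nlip_cst|exact: nlipZ].
have Acup : [set x | 0 < f x] = \bigcup_k [set x | k.+1%:R^-1 < f x].
  apply/seteqP; split => x /=; last by move=> [k _] /=; apply: lt_trans.
  move=> fx0; exists (Num.truncn (f x)^-1) => //=.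
  rewrite -[ltRHS]invrK ltf_pV2 ?posrE ?invr_gt0//; exact: truncnS_gt.
have le12 (m m' : {measure set (borel E) -> \bar R}) :
    (forall k, \int[m]_x (s k x)%:E = \int[m']_x (s k x)%:E)%E ->
    (m [set x | (0 < f x)%R] <= m' [set x | (0 < f x)%R])%E.
  move=> mm'; rewrite [in leLHS]Acup.
  have cvgm : (m [set x | k.+1%:R^-1 < f x]%R) @[k --> \oo] -->
      m (\bigcup_k [set x | k.+1%:R^-1 < f x]%R).
    apply: nondecreasing_cvg_mu => //; first by rewrite -Acup.
    move=> i j ij; apply/subsetPset => x /=; apply: le_lt_trans.
    by rewrite lef_pV2 ?posrE// ler_nat ltnS.
  rewrite -(cvg_lim _ cvgm)//; apply: lime_le; first by apply/cvg_ex; eexists; exact: cvgm.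
  apply: nearW => k; apply: (@le_trans _ _ (\int[m]_x (s k x)%:E)%E).
    apply: measure_le_integral => // x /= kf; rewrite /s le_min lexx/=.
    by rewrite mulrC -ler_pdivrMr// div1r ltW.
  rewrite mm' -[X in (_ <= m' X)%E]setIT -integral_indic//; apply: ge0_le_integral => //.
  - by move=> x _; rewrite lee_fin; have [] := ns k.
  - by apply/measurable_EFinP; exact: measurable_nlip.
  - by apply/measurable_EFinP; exact: measurable_indic.
  - move=> x _; rewrite lee_fin indicE; case: (boolP (x \in _)) => [_|].
      by rewrite ge_min lexx.
    rewrite notin_setE /= => /negP; rewrite -leNgt => fx0.
    have fx : f x = 0 by apply/eqP; rewrite eq_le fx0 f0.
    by rewrite /s fx /= ge_min mulr0 lexx orbT.
have s1 k x : s k x <= 1 by rewrite ge_min lexx.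
by apply/eqP; rewrite eq_le !le12// => k; rewrite m12.
Qed.

End borel_generation.

(** * Daniell representation on Lipschitz functions *)

Section daniell.
Context (R : realType) (E : completeMetricType R).
Hypothesis dist_le1 : forall x y : E, mdist x y <= 1.
Hypothesis E_separable : separable E.
Variable L : (E -> R) -> R.
Hypothesis L_ge0 : forall f, nlip f -> 0 <= L f.
Hypothesis LD : forall f g, nlip f -> nlip g -> L (fun x => f x + g x) = L f + L g.
Hypothesis LZ : forall (c : R) f, 0 <= c -> nlip f -> L (fun x => c * f x) = c * L f.
Hypothesis L1 : L (fun=> 1) = 1.
Hypothesis L_cover : forall (h : nat -> E -> R) c,
  (forall n, nlip (h n)) -> (forall x, {homo h^~ x : m n / (m <= n)%N >-> m <= n}) ->
  (forall n, L (h n) <= c) -> (forall x, exists n, 1 <= h n x) -> 1 <= c.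
Implicit Types (f g : E -> R) (A B X : set E).

Lemma L_le f g : nlip f -> nlip g -> (forall x, f x <= g x) -> L f <= L g.
Proof.
move=> nf ng fg.
have -> : g = (fun x => f x + (g x - f x)) by apply/funext => x; rewrite subrKC.
by rewrite LD ?lerDl ?L_ge0//; exact: nlipB.
Qed.

Lemma LB f g : nlip f -> nlip g -> (forall x, g x <= f x) ->
  L (fun x => f x - g x) = L f - L g.
Proof.
move=> nf ng gf; apply/eqP; rewrite eq_sym subr_eq -LD//; last exact: nlipB.
by apply/eqP; congr L; apply/funext => x; rewrite subrK.
Qed.

Lemma L0 : L (fun=> 0) = 0.
Proof.
transitivity (0 * L (fun=> 1)); last by rewrite mul0r.
rewrite -LZ//; last exact: nlip_cst.
by congr L; apply/funext => x; rewrite mul0r.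
Qed.

(** A cover is an increasing sequence of functions rather than a series: the
    union of countably many covered sets is then covered by the diagonal
    partial sums, and no re-indexing of a double series is needed. *)
Definition covers A (h : nat -> E -> R) c := [/\ forall n, nlip (h n),
  forall x, {homo h^~ x : m n / (m <= n)%N >-> m <= n},
  forall n, L (h n) <= c & forall x, A x -> exists n, 1 <= h n x].

Definition cover_costs A := [set c | exists h, covers A h c].
Definition cover_mass A := inf (cover_costs A).

Lemma cover_costs_lb A : lbound (cover_costs A) 0.
Proof. by move=> c [h [nh _ Lh _]]; exact: le_trans (L_ge0 (nh 0%N)) (Lh 0%N). Qed.

Lemma cover_costs1 A : cover_costs A 1.
Proof.
exists (fun=> fun=> 1); split => //.
- by move=> _; exact: nlip_cst.
- by move=> x m n _; exact: lexx.
- by move=> _; rewrite L1.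
- by move=> x _; exists 0%N.
Qed.

Lemma cover_costs_has_inf A : has_inf (cover_costs A).
Proof. by split; [exists 1; exact: cover_costs1|exists 0; exact: cover_costs_lb]. Qed.

Lemma cover_mass_le A h c : covers A h c -> cover_mass A <= c.
Proof.
by move=> Ahc; apply: ge_inf; [exact: (cover_costs_has_inf A).2|exists h].
Qed.

Lemma cover_mass_le1 A : cover_mass A <= 1.
Proof.
by apply: ge_inf; [exact: (cover_costs_has_inf A).2|exact: cover_costs1].
Qed.

Lemma cover_mass_ge0 A : 0 <= cover_mass A.
Proof.
by apply: lb_le_inf; [exact: (cover_costs_has_inf A).1|exact: cover_costs_lb].
Qed.

Lemma cover_mass_adherent A e : 0 < e ->
  exists h, exists2 c, covers A h c & c < cover_mass A + e.
Proof.
move=> e0; have [c [h hc] ce] := inf_adherent e0 (cover_costs_has_inf A).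
by exists h, c.
Qed.

Lemma cover_mass_mono A B : A `<=` B -> cover_mass A <= cover_mass B.
Proof.
move=> AB; apply: lb_le_inf; first exact: (cover_costs_has_inf B).1.
move=> c [h [nh ndh Lh hB]]; apply: (@cover_mass_le _ h); split=> //.
by move=> x /AB; exact: hB.
Qed.

Lemma cover_mass0 : cover_mass set0 = 0.
Proof.
apply/eqP; rewrite eq_le cover_mass_ge0 andbT.
apply: (@cover_mass_le _ (fun=> fun=> 0)); split => //.
- by move=> _; exact: nlip_cst.
- by move=> x m n _; exact: lexx.
- by move=> _; rewrite L0.
Qed.

Lemma L_sum (h : nat -> E -> R) n : (forall i, nlip (h i)) ->
  nlip (fun x => \sum_(i < n) h i x) /\
  L (fun x => \sum_(i < n) h i x) = \sum_(i < n) L (h i).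
Proof.
move=> nh; elim: n => [|n [IHn IHL]].
  have -> : (fun x => \sum_(i < 0) h i x) = (fun=> 0).
    by apply/funext => x; rewrite big_ord0.
  by rewrite L0 big_ord0; split => //; exact: nlip_cst.
have -> : (fun x => \sum_(i < n.+1) h i x) = (fun x => \sum_(i < n) h i x + h n x).
  by apply/funext => x; rewrite big_ord_recr.
by rewrite LD// IHL big_ord_recr; split => //; exact: nlipD.
Qed.

(** With h i a cover of A i of cost at most the mass of A i plus
    e / 2 ^ (i + 1), the functions \sum_(i < n) h i n increase with n and cover
    the union. *)
Lemma cover_mass_bigcup (A : nat -> set E) s :
  (forall n, \sum_(i < n) cover_mass (A i) <= s) ->
  cover_mass (\bigcup_n A n) <= s.
Proof.
move=> As; apply/ler_addgt0Pr => e e0.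
have e2 n : 0 < e / 2 ^+ n.+1 by rewrite divr_gt0// exprn_gt0.
have /choice[h /choice[c hc]] n : exists h, exists c,
    covers (A n) h c /\ c < cover_mass (A n) + e / 2 ^+ n.+1.
  by have [h [c hc ce]] := cover_mass_adherent (A n) (e2 n); exists h, c.
have sum_e n : \sum_(i < n) e / 2 ^+ i.+1 = e - e / 2 ^+ n.
  elim: n => [|n IHn]; first by rewrite big_ord0 expr0 divr1 subrr.
  rewrite big_ord_recr/= IHn exprS.
  by field; rewrite expf_neq0.
pose H n x := \sum_(i < n) h i n x.
have nh i n : nlip (h i n) by have [[]] := hc i.
apply: (@cover_mass_le _ H); split.
- by move=> n; exact: (L_sum n (fun i => nh i n)).1.
- move=> x m n mn; rewrite /H (big_ord_widen n (fun i => h i m x) mn).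
  rewrite big_mkcond/=; apply: ler_sum => i _.
  case: ifP => _; last by have [] := nh i n.
  by have [[_ ndh _ _] _] := hc i; exact: ndh.
- move=> n; rewrite (L_sum n (fun i => nh i n)).2.
  apply: (@le_trans _ _ (\sum_(i < n) (cover_mass (A i) + e / 2 ^+ i.+1))).
    apply: ler_sum => i _; have [[_ _ Lh _] ce] := hc i.
    exact: le_trans (Lh n) (ltW ce).
  have en0 : 0 <= e / 2 ^+ n by rewrite divr_ge0 ?exprn_ge0// ltW.
  by rewrite big_split/= sum_e; have := As n; lra.
- move=> x [i _ Aix]; have [[_ ndh _ hA] _] := hc i.
  have [n hn] := hA x Aix; exists (maxn n i.+1).
  have ltiM : (i < maxn n i.+1)%N by rewrite leq_max leqnn orbT.
  rewrite /H (bigD1 (Ordinal ltiM))//=.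
  apply: le_trans (le_trans hn (ndh x n (maxn n i.+1) (leq_maxl _ _))) _.
  by rewrite lerDl sumr_ge0// => j _; have [] := nh j (maxn n i.+1).
Qed.

Definition outer A : \bar R := (cover_mass A)%:E.

Let outer0 : outer set0 = 0%E. Proof. by rewrite /outer cover_mass0. Qed.

Let outer_ge0 A : (0 <= outer A)%E. Proof. by rewrite lee_fin cover_mass_ge0. Qed.

Let outer_mono : {homo outer : A B / A `<=` B >-> (A <= B)%E}.
Proof. by move=> A B AB; rewrite lee_fin cover_mass_mono. Qed.

Let outer_sigma_subadditive : sigma_subadditive outer.
Proof.
move=> A; rewrite /outer.
have lim_ge n : ((\sum_(i < n) cover_mass (A i))%:E <= \sum_(i <oo) outer (A i))%E.
  rewrite -sumEFin -(big_mkord xpredT (fun i => outer (A i))).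
  by apply: nneseries_lim_ge.
case: (\sum_(i <oo) outer (A i))%E lim_ge => [s| |] lim_ge.
- by rewrite lee_fin; apply: cover_mass_bigcup => n; rewrite -lee_fin.
- exact: leey.
- by have := lim_ge 0%N; rewrite leeNy_eq.
Qed.

HB.instance Definition _ := isOuterMeasure.Build R E outer
  outer0 outer_ge0 outer_mono outer_sigma_subadditive.

Lemma nondecreasing_bounded_cvg (u : nat -> R) c :
  {homo u : m n / (m <= n)%N >-> m <= n} -> (forall n, u n <= c) ->
  forall e, 0 < e -> exists n, forall m, u m <= u n + e.
Proof.
move=> ndu uc e e0.
have us : has_sup (range u).
  by split; [exists (u 0%N), 0%N|exists c => _ [n _ <-]].
have [_ [n _ <-] un] := sup_adherent e0 us.
exists n => m; rewrite -lerBlDr.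
apply: le_trans (ltW un); rewrite lerD2r.
by apply: ub_le_sup; [exact: us.2|exists m].
Qed.

(** Let s k = min(1, k f), which increases to the indicator of G = {f > 0}. For
    a cover h of X and t = s (2 i), the products h t and h (1 - t) cover the
    part of X where s i > 1/2 (there t = 1) and the part outside G (there
    t = 0), at total cost at most that of h. The remaining part of G, where
    s i <= 1/2, is covered by the functions 2 (s (i + k) - s i), whose cost is
    twice the tail of the bounded increasing sequence L (s k). *)
Lemma caratheodory_positive f : nlip f -> outer.-caratheodory [set x | 0 < f x].
Proof.
move=> nf; set G := [set x | 0 < f x].
apply: (le_caratheodory_measurable (mu := outer)) => X; rewrite /outer -EFinD lee_fin.
apply: lb_le_inf; first exact: (cover_costs_has_inf X).1.
move=> c [h hX]; have [nh ndh Lh hc] := hX.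
pose s (k : nat) x := Num.min 1 (k%:R * f x).
have f0 x : 0 <= f x by have [] := nf.
have ns k : nlip (s k) by apply: nlip_min; [exact: nlip_cst|exact: nlipZ].
have s0 k x : 0 <= s k x by have [] := ns k.
have s1 k x : s k x <= 1 by rewrite ge_min lexx.
have nds x : {homo s^~ x : m n / (m <= n)%N >-> m <= n}.
  move=> m n mn; rewrite /s le_min ge_min lexx/= ge_min; apply/orP; right.
  by rewrite ler_wpM2r// ler_nat.
apply/ler_addgt0Pr => e e0.
have [|||i si] := @nondecreasing_bounded_cvg (fun k => L (s k)) 1 _ _ (e / 2).
- by move=> m n mn; apply: L_le => // x; exact: nds.
- by move=> n; rewrite -L1; apply: L_le => //; exact: nlip_cst.
- by rewrite divr_gt0.
have thin : cover_mass (G `&` [set x | s i x <= 1 / 2]) <= e.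
  apply: (@cover_mass_le _ (fun k x => 2 * (s (i + k)%N x - s i x))); split.
  + by move=> n; apply: nlipZ => //; apply: nlipB => // x; rewrite nds// leq_addr.
  + by move=> x m n mn; rewrite ler_wpM2l// lerD2r nds// leq_add2l.
  + move=> n; rewrite LZ//; last by apply: nlipB => // x; rewrite nds// leq_addr.
    rewrite LB//; last by move=> x; rewrite nds// leq_addr.
    have := si (i + n)%N; lra.
  + move=> x [/= Gx six].
    exists (Num.truncn (f x)^-1).+1.
    suff -> : s (i + (Num.truncn (f x)^-1).+1)%N x = 1 by lra.
    apply/eqP; rewrite eq_le s1/= /s le_min lexx/=.
    rewrite -ler_pdivrMr// div1r.
    apply: ltW; apply: lt_le_trans (truncnS_gt _) _.
    by rewrite ler_nat leq_addl.
pose t := s (2 * i)%N.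
have tx x : 1 / 2 < s i x -> t x = 1.
  rewrite /t /s => h2; apply/eqP; rewrite eq_le ge_min lexx/= le_min lexx/=.
  have : 1 / 2 < i%:R * f x by apply: lt_le_trans h2 _; rewrite ge_min lexx orbT.
  by rewrite natrM; lra.
have t0 x : ~ G x -> t x = 0.
  move=> /negP; rewrite -leNgt => fx0.
  have fx : f x = 0 by apply/eqP; rewrite eq_le fx0 f0.
  by rewrite /t /s fx mulr0 minElt ltr10.
have nt : nlip t by exact: ns.
have nt' : nlip (fun x => 1 - t x).
  by apply: nlipB => //; [exact: nlip_cst|move=> x; exact: s1].
pose h1 n x := h n x * t x; pose h2 n x := h n x * (1 - t x).
have nh1 n : nlip (h1 n) by exact: nlipM.
have nh2 n : nlip (h2 n) by exact: nlipM.
have ndh1 x : {homo h1^~ x : m n / (m <= n)%N >-> m <= n}.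
  by move=> m n mn; exact: ler_wpM2r (s0 _ _) _ _ (ndh x m n mn).
have ndh2 x : {homo h2^~ x : m n / (m <= n)%N >-> m <= n}.
  move=> m n mn; apply: ler_wpM2r; last exact: ndh.
  by rewrite subr_ge0; exact: s1.
have Lh12 n : L (h1 n) + L (h2 n) = L (h n).
  by rewrite -LD//; congr L; apply/funext => x; rewrite /h1 /h2; ring.
have L1c n : L (h1 n) <= c.
  by have := Lh n; rewrite -(Lh12 n); have := L_ge0 (nh2 n); lra.
have L2c n : L (h2 n) <= c.
  by have := Lh n; rewrite -(Lh12 n); have := L_ge0 (nh1 n); lra.
have fat : cover_mass (X `&` [set x | 1 / 2 < s i x]) + cover_mass (X `&` ~` G) <= c.
  apply/ler_addgt0Pr => e' e'0.
  have [|||n1 hn1] := @nondecreasing_bounded_cvg (fun k => L (h1 k)) c _ _ (e' / 2).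
  - by move=> m n mn; apply: L_le => // x; exact: ndh1.
  - exact: L1c.
  - by rewrite divr_gt0.
  have [|||n2 hn2] := @nondecreasing_bounded_cvg (fun k => L (h2 k)) c _ _ (e' / 2).
  - by move=> m n mn; apply: L_le => // x; exact: ndh2.
  - exact: L2c.
  - by rewrite divr_gt0.
  have c1 : cover_mass (X `&` [set x | 1 / 2 < s i x]) <= L (h1 n1) + e' / 2.
    apply: (@cover_mass_le _ h1); split => // x [Xx /= /tx tx1].
    by have [n hn] := hc x Xx; exists n; rewrite /h1 tx1 mulr1.
  have c2 : cover_mass (X `&` ~` G) <= L (h2 n2) + e' / 2.
    apply: (@cover_mass_le _ h2); split => // x [Xx /= /t0 tx0].
    by have [n hn] := hc x Xx; exists n; rewrite /h2 tx0 subr0 mulr1.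
  pose n := maxn n1 n2.
  have g1 : L (h1 n1) <= L (h1 n) by apply: L_le => // x; rewrite ndh1// leq_maxl.
  have g2 : L (h2 n2) <= L (h2 n) by apply: L_le => // x; rewrite ndh2// leq_maxr.
  have := Lh n; rewrite -(Lh12 n); lra.
have split_G : cover_mass (X `&` G) <=
    cover_mass (X `&` [set x | 1 / 2 < s i x]) +
    cover_mass (G `&` [set x | s i x <= 1 / 2]).
  rewrite -lee_fin EFinD; apply: le_trans (outer_measureU2 outer _ _).
  apply: outer_mono => x [Xx Gx]; have [sx|sx] := leP (s i x) (1 / 2).
    by right.
  by left.
lra.
Qed.

Lemma cover_massT : cover_mass setT = 1.
Proof.
apply/eqP; rewrite eq_le cover_mass_le1; apply: lb_le_inf.
  exact: (cover_costs_has_inf setT).1.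
by move=> c [h [nh ndh Lh hT]]; apply: (L_cover nh ndh Lh) => x; exact: hT.
Qed.

Definition daniell_measure (A : set (borel E)) : \bar R := outer A.

Lemma borel_caratheodory (A : set (borel E)) : measurable A -> outer.-caratheodory A.
Proof.
rewrite measurable_positive_sets//; apply: smallest_sub => {A}; last first.
  by move=> _ [f nf ->]; exact: caratheodory_positive.
split.
- exact: (caratheodory_measurable_set0 outer).
- by move=> A cA; rewrite setTD; exact: (@caratheodory_measurable_setC _ _ outer).
- exact: (@caratheodory_measurable_bigcup _ _ outer).
Qed.

Let daniell0 : daniell_measure set0 = 0%E. Proof. exact: outer_measure0. Qed.

Let daniell_ge0 A : (0 <= daniell_measure A)%E. Proof. exact: outer_measure_ge0. Qed.

Let daniell_sigma_additive : semi_sigma_additive daniell_measure.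
Proof.
move=> A mA tA mUA.
apply: (@caratheodory_measure_sigma_additive _ _ outer A) => //.
- by move=> n; exact: borel_caratheodory.
- exact: borel_caratheodory.
Qed.

HB.instance Definition _ := isMeasure.Build _ (borel E) R daniell_measure
  daniell0 daniell_ge0 daniell_sigma_additive.

Let daniellT : daniell_measure setT = 1%E.
Proof. by rewrite /daniell_measure /outer cover_massT. Qed.

HB.instance Definition _ := Measure_isProbability.Build _ (borel E) R
  daniell_measure daniellT.

(** Cut f into N = n + 1 horizontal layers q i of height 1 / N. Each layer is at
    most 1 / N times the indicator of {f > i / N}, while N q i is at least 1 on
    {f > (i + 1) / N} and so bounds the mass of that set; shifting the index
    by one costs 1 / N. *)
Lemma daniell_integral_le f : nlip f -> (forall x, f x <= 1) ->
  (\int[daniell_measure]_x (f x)%:E <= (L f)%:E)%E.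
Proof.
move=> nf f1; have f0 x : 0 <= f x by have [] := nf.
suff H (n : nat) : (\int[daniell_measure]_x (f x)%:E <= (L f + n.+1%:R^-1)%:E)%E.
  apply/lee_addgt0Pr => e e0; apply: le_trans (H (Num.truncn e^-1)) _.
  rewrite -EFinD lee_fin lerD2l -[leRHS]invrK lef_pV2 ?posrE ?invr_gt0//.
  by rewrite ltW// truncnS_gt.
pose N : R := n.+1%:R.
have N0 : 0 < N by rewrite ltr0n.
have N_neq0 : N != 0 by exact: lt0r_neq0.
pose cut i x := Num.min (f x) (i%:R / N).
have ncut i : nlip (cut i).
  by apply: nlip_min => //; apply: nlip_cst; rewrite divr_ge0// ltW.
have cut_le i x : cut i x <= cut i.+1 x.
  rewrite le_min ge_min lexx/= ge_min; apply/orP; right.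
  by rewrite ler_pM2r ?invr_gt0// ler_nat.
pose q i x := cut i.+1 x - cut i x.
have nq i : nlip (q i) by exact: nlipB.
have q0 i x : 0 <= q i x by have [] := nq i.
have step i : i.+1%:R / N = i%:R / N + N^-1 :> R.
  by rewrite -natr1 mulrDl mul1r.
have Ni0 : 0 < N^-1 by rewrite invr_gt0.
have q_le i x : q i x <= N^-1.
  rewrite /q /cut step; move: (i%:R / N) (N^-1) Ni0 (f x) => a u u0 y.
  by rewrite !minElt; case: ltP => ?; case: ltP => ?; lra.
have q_off i x : f x <= i%:R / N -> q i x = 0.
  move=> fi; rewrite /q /cut step.
  by rewrite !min_l ?subrr// (le_trans fi)// lerDl ltW.
have q_on i x : i.+1%:R / N < f x -> q i x = N^-1.
  move=> fi; have h1 := ltW fi.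
  have h2 : i%:R / N <= f x by rewrite (le_trans _ h1)// step lerDl ltW.
  by rewrite /q /cut (min_r h1) (min_r h2) step addrAC subrr add0r.
have sum_q k x : \sum_(i < k) q i x = cut k x.
  elim: k => [|k IHk].
    by rewrite big_ord0 /cut mul0r (min_r (f0 x)).
  by rewrite big_ord_recr/= IHk /q addrC subrK.
have cutN x : cut n.+1 x = f x by rewrite /cut (divff N_neq0) (min_l (f1 x)).
have mgt (r : R) : measurable ([set x | r < f x] : set (borel E)).
  by apply: sub_sigma_algebra; exact: nlip_open_gt.
have q_int i : (\int[daniell_measure]_x (q i x)%:E <=
    (N^-1 * cover_mass [set x | i%:R / N < f x]%R)%:E)%E.
  pose A : set (borel E) := [set x | i%:R / N < f x].
  have mA : measurable A by exact: mgt.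
  apply: (@le_trans _ _ (\int[daniell_measure]_x (N^-1%:E * (\1_A x)%:E))%E).
    apply: ge0_le_integral => //.
    - by move=> x _; rewrite lee_fin.
    - by apply/measurable_EFinP; exact: measurable_nlip.
    - by apply: measurable_funeM; apply/measurable_EFinP; exact: measurable_indic.
    - move=> x _; rewrite -EFinM lee_fin indicE.
      case: (boolP (x \in A)) => [_|]; first by rewrite mulr1.
      by rewrite notin_setE /A/= => /negP; rewrite -leNgt => /q_off ->; rewrite mulr0.
  rewrite ge0_integralZl//.
  + by rewrite integral_indic// setIT EFinM.
  + by apply/measurable_EFinP; exact: measurable_indic.
  + by rewrite lee_fin ltW.
have mass_gt i : N^-1 * cover_mass [set x | i.+1%:R / N < f x]%R <= L (q i).
  rewrite ler_pdivrMl//.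
  apply: (@cover_mass_le _ (fun=> fun x => N * q i x)); split.
  - by move=> _; apply: nlipZ => //; exact: ltW.
  - by move=> x k m _; exact: lexx.
  - by move=> _; rewrite (LZ (ltW N0) (nq i)).
  - by move=> x /= /q_on qx; exists 0%N; rewrite qx divff.
have Lsum k : \sum_(i < k) L (q i) <= L f.
  rewrite -(L_sum k nq).2; apply: L_le => //; first exact: (L_sum k nq).1.
  by move=> x; rewrite sum_q ge_min lexx.
have -> : (\int[daniell_measure]_x (f x)%:E =
    \sum_(i < n.+1) \int[daniell_measure]_x (q i x)%:E)%E.
  rewrite -ge0_integral_sum//; last 2 first.
  - by move=> i; apply/measurable_EFinP; exact: measurable_nlip.
  - by move=> i x _; rewrite lee_fin.
  by apply: eq_integral => x _; rewrite sumEFin sum_q cutN.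
apply: (@le_trans _ _ (\sum_(i < n.+1)
    (N^-1 * cover_mass [set x | (i%:R / N < f x)%R])%:E)%E).
  by apply: lee_sum => i _; exact: q_int.
rewrite sumEFin lee_fin big_ord_recl addrC; apply: lerD; last first.
  by rewrite ler_piMr ?cover_mass_le1// ltW.
by apply: le_trans (Lsum n); apply: ler_sum => i _; exact: mass_gt.
Qed.

(** The reverse inequality is [daniell_integral_le] for 1 - f, since both the
    measure and L have total mass 1. *)
Lemma daniell : exists pi : probability (borel E) R,
  forall f, nlip f -> (forall x, f x <= 1) -> (\int[pi]_x (f x)%:E = (L f)%:E)%E.
Proof.
pose pi : probability (borel E) R := daniell_measure.
exists pi => f nf f1; apply/eqP; rewrite eq_le daniell_integral_le//=.
have f0 x : 0 <= f x by have [] := nf.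
have ng : nlip (fun x => 1 - f x) by apply: nlipB => //; exact: nlip_cst.
have g1 x : 1 - f x <= 1 by rewrite gerBl.
have := daniell_integral_le ng g1.
rewrite LB//; last exact: nlip_cst.
have : (\int[pi]_x (f x)%:E + \int[pi]_x (1 - f x)%R%:E = 1)%E.
  rewrite -ge0_integralD//.
  - under eq_integral do rewrite -EFinD subrKC.
    by rewrite integral_cst// mul1e; exact: daniellT.
  - by move=> x _; rewrite lee_fin.
  - by apply/measurable_EFinP; exact: measurable_nlip.
  - by move=> x _; rewrite lee_fin subr_ge0.
  - by apply/measurable_EFinP; exact: measurable_nlip ng.
rewrite L1.
move: (\int[pi]_x (f x)%:E)%E (\int[pi]_x (1 - f x)%R%:E)%E => [a| |] [b| |] //.
by rewrite -EFinD => -[ab]; rewrite !lee_fin; lra.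
Qed.

End daniell.

(** * Tightness and weak completeness *)

Section tightness.
Context (R : realType) (E : completeMetricType R).
Hypothesis dist_le1 : forall x y : E, mdist x y <= 1.
Variable s : nat -> E.
Hypothesis s_dense : forall x r, 0 < r -> exists n, mdist (s n) x < r.

(** Distance to the first k points of the dense sequence, truncated at 1, which
    serves as the minimum over no point. *)
Fixpoint min_dist (k : nat) (x : E) : R :=
  if k is k'.+1 then Num.min (min_dist k' x) (mdist (s k') x) else 1.

Lemma nlip_min_dist k : nlip (min_dist k).
Proof.
by elim: k => [|k IHk] /=; [exact: nlip_cst|exact/nlip_min/nlip_dist].
Qed.

Lemma min_dist_lip1 k : lip_with 1 (min_dist k).
Proof.
elim: k => [|k IHk] x y /=; first by rewrite lerDl mul1r mdist_ge0.
have := IHk x y; have := metric_triangle (s k) y x; rewrite (metric_sym y x).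
by rewrite !minElt mul1r; case: ltP => ?; case: ltP => ?; lra.
Qed.

Lemma min_dist_nonincreasing x : {homo min_dist^~ x : m n / (m <= n)%N >-> n <= m}.
Proof.
move=> m n /subnK <-; elim: (n - m)%N => [|k IHk] //=.
by rewrite ge_min IHk.
Qed.

Lemma min_dist_lt x r : 0 < r -> exists k, min_dist k x < r.
Proof.
move=> r0; have [n sn] := s_dense x r0.
by exists n.+1; rewrite /= gt_min sn orbT.
Qed.

(** The set is totally bounded and closed in a complete space. In terms of
    ultrafilters: one containing it picks, at each scale r j, one of finitely
    many balls, so it is Cauchy. *)
Lemma compact_min_dist (k : nat -> nat) (r : nat -> R) :
  (forall e, 0 < e -> exists j, r j < e) ->
  compact (\bigcap_j [set x | min_dist (k j) x <= r j]).
Proof.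
move=> r_small; set K := (X in compact X).
have K_closed : closed K by apply: closed_bigI => j _; exact/nlip_closed_le/nlip_min_dist.
rewrite compact_ultra => F FU FK.
have ball_of j t : t < 1 -> F [set x | min_dist j x <= t] ->
    exists i, F [set x | mdist (s i) x <= t].
  move=> t1; elim: j => [|j IHj].
    by move=> /filter_ex[x /=]; rewrite leNgt t1.
  move=> Fj; have [/IHj//|Fj'] := in_ultra_setVsetC [set x | min_dist j x <= t] FU.
  exists j; apply: filterS (filterI Fj Fj') => x /= [+ /negP /negbTE jt].
  by rewrite ge_min jt.
have F_cauchy : cauchy F.
  apply: cauchy_exP => e e0.
  have e'0 : 0 < Num.min e 1 by rewrite lt_min e0 ltr01.
  have [j] := r_small _ e'0; rewrite lt_min => /andP[rje rj1].
  have [|i Fi] := ball_of (k j) (r j) rj1.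
    by apply: filterS FK => x Kx; exact: Kx.
  exists (s i); rewrite ballEmdist; apply: filterS Fi => x /= sx.
  exact: le_lt_trans rje.
have Fp : F --> lim F by exact: cauchy_cvg.
exists (lim F); split => //; apply: K_closed => B pB.
by apply: (@filter_ex _ F); apply: filterI => //; exact: Fp.
Qed.

End tightness.

Section nlip_integral.
Context (R : realType) (E : completeMetricType R).
Hypothesis dist_le1 : forall x y : E, mdist x y <= 1.
Variable m : {measure set (borel E) -> \bar R}.
Hypothesis mT : m setT = 1%E.
Implicit Types f g : E -> R.

Lemma nlip_integral_fin f : nlip f -> (\int[m]_x (f x)%:E)%E \is a fin_num.
Proof.
move=> nf; have f0 x : 0 <= f x by have [] := nf.
have [B B0 fB] := nlip_bounded dist_le1 nf.
rewrite ge0_fin_numE; last by apply: integral_ge0 => x _; rewrite lee_fin.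
apply: (@le_lt_trans _ _ (\int[m]_(x in setT) B%:E)%E).
  apply: ge0_le_integral => //.
  - by move=> x _; rewrite lee_fin.
  - by apply/measurable_EFinP; exact: measurable_nlip.
  - by move=> x _; rewrite lee_fin.
by rewrite integral_cst// [X in (_ * X)%E]mT mule1 ltry.
Qed.

Definition nlip_int f := fine (\int[m]_x (f x)%:E).

Lemma nlip_intE f : nlip f -> (\int[m]_x (f x)%:E = (nlip_int f)%:E)%E.
Proof. by move=> nf; rewrite fineK// nlip_integral_fin. Qed.

Lemma nlip_int_ge0 f : nlip f -> 0 <= nlip_int f.
Proof.
move=> nf; rewrite -lee_fin -nlip_intE//; apply: integral_ge0 => x _.
by rewrite lee_fin; have [] := nf.
Qed.

Lemma nlip_intD f g : nlip f -> nlip g ->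
  nlip_int (fun x => f x + g x) = nlip_int f + nlip_int g.
Proof.
move=> nf ng; apply/EFin_inj; rewrite EFinD -!nlip_intE//; last exact: nlipD.
under eq_integral do rewrite EFinD.
rewrite ge0_integralD//.
- by move=> x _; rewrite lee_fin; have [] := nf.
- by apply/measurable_EFinP; exact: measurable_nlip.
- by move=> x _; rewrite lee_fin; have [] := ng.
- by apply/measurable_EFinP; exact: measurable_nlip.
Qed.

Lemma nlip_intZ c f : 0 <= c -> nlip f ->
  nlip_int (fun x => c * f x) = c * nlip_int f.
Proof.
move=> c0 nf; apply/EFin_inj; rewrite EFinM -!nlip_intE//; last exact: nlipZ.
under eq_integral do rewrite EFinM.
rewrite ge0_integralZl//.
- by apply/measurable_EFinP; exact: measurable_nlip.
- by move=> x _; rewrite lee_fin; have [] := nf.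
Qed.

Lemma nlip_int_cst c : nlip_int (fun=> c) = c.
Proof. by rewrite /nlip_int integral_cst// [X in (_ * X)%E]mT mule1. Qed.

Lemma nlip_int_le f g : nlip f -> nlip g -> (forall x, f x <= g x) ->
  nlip_int f <= nlip_int g.
Proof.
move=> nf ng fg; rewrite -lee_fin -!nlip_intE//; apply: ge0_le_integral => //.
- by move=> x _; rewrite lee_fin; have [] := nf.
- by apply/measurable_EFinP; exact: measurable_nlip.
- by apply/measurable_EFinP; exact: measurable_nlip.
- by move=> x _; rewrite lee_fin.
Qed.

End nlip_integral.

Section weak_completeness.
Context (R : realType) (E : completeMetricType R).
Hypothesis dist_le1 : forall x y : E, mdist x y <= 1.
Hypothesis E_separable : separable E.
Variable mu : nat -> {measure set (borel E) -> \bar R}.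
Hypothesis muT : forall n, mu n setT = 1%E.
Hypothesis mu_cauchy : forall e : R, 0 < e -> exists N, forall m n,
  (N <= m)%N -> (N <= n)%N -> forall f, nlip f -> lip_with 1 f ->
  nlip_int (mu m) f <= nlip_int (mu n) f + e.
Implicit Types f g : E -> R.

(** For each fixed n this is dominated convergence. The Cauchy property passes
    it on to all large n, because truncated distances are 1-Lipschitz for every
    k; finitely many n remain. *)
Lemma min_dist_int_small (s : nat -> E) :
  (forall x r, 0 < r -> exists n, mdist (s n) x < r) ->
  forall e, 0 < e -> exists k, forall n, nlip_int (mu n) (min_dist s k) <= e.
Proof.
move=> ds e e0; have e2 : 0 < e / 2 by rewrite divr_gt0.
have nmd k := nlip_min_dist s k.
have single n : exists k, nlip_int (mu n) (min_dist s k) <= e / 2.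
  have : (\int[mu n]_x (min_dist s k x)%:E @[k --> \oo] --> \int[mu n]_x (cst 0 x))%E.
    have [|||||_ _ +] := @dominated_convergence _ _ _ (mu n) setT measurableT
      (fun k x => (min_dist s k x)%:E) (cst 0%E) (cst 1%E).
    - by move=> k; apply/measurable_EFinP; exact: measurable_nlip.
    - exact: measurable_cst.
    - apply: aeW => x _; apply: cvg_EFin; first exact: nearW.
      apply/cvgrPdist_lt => r r0; have [k kr] := min_dist_lt ds x r0.
      exists k => // j /= kj; rewrite sub0r normrN ger0_norm; last by have [] := nmd j.
      by apply: le_lt_trans kr; exact: min_dist_nonincreasing.
    - apply/integrableP; split; first exact: measurable_cst.
      under eq_integral do rewrite /= normr1.
      by rewrite integral_cst// mul1e [ltLHS]muT ltry.
    - apply: aeW => x k _ /=; rewrite lee_fin ger0_norm; last by have [] := nmd k.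
      by apply: (@min_dist_nonincreasing _ _ s x 0%N k).
    - exact.
  rewrite integral0 => /fine_cvg/cvgrPdist_lt/(_ _ e2)[k _ /(_ k (leqnn k))] /=.
  rewrite sub0r normrN ger0_norm; last exact: nlip_int_ge0.
  by move=> /ltW ?; exists k.
have [N NP] := mu_cauchy e2.
have /choice[k kP] := single.
exists (\max_(i < N.+1) k i)%N => n.
have le_max i : (i <= N)%N ->
    nlip_int (mu i) (min_dist s (\max_(j < N.+1) k j)%N) <= e / 2.
  rewrite -ltnS => iN; apply: le_trans (kP i); apply: nlip_int_le => // x.
  apply: min_dist_nonincreasing.
  exact: (@leq_bigmax _ (fun j : 'I_N.+1 => k j) (Ordinal iN)).
have [nN|/ltnW Nn] := leqP n N.
  by apply: le_trans (le_max n nN) _; lra.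
apply: le_trans (NP n N Nn (leqnn N) _ (nmd _) (min_dist_lip1 s _)) _.
by have := le_max N (leqnn N); lra.
Qed.

(** By Markov's inequality the set where the truncated distance to k j points
    exceeds r j = 2 ^ -(j + 1) has mass at most e r j, provided that the
    corresponding integral is at most e (r j) ^ 2. *)
Lemma uniformly_tight e : 0 < e -> exists K : set (borel E),
  [/\ compact (K : set E), measurable K & forall n, (mu n (~` K) <= e%:E)%E].
Proof.
move=> e0; have [s ds] := dense_sequence E_separable.
pose r j : R := (2 ^ j.+1)%:R^-1.
have r0 j : 0 < r j by rewrite invr_gt0 ltr0n expn_gt0.
have /choice[k kP] j : exists k, forall n,
    nlip_int (mu n) (min_dist s k) <= e * r j * r j.
  by apply: min_dist_int_small => //; rewrite !mulr_gt0.
pose U j : set (borel E) := [set x | r j < min_dist s (k j) x].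
have mU j : measurable (U j).
  by apply: sub_sigma_algebra; exact/nlip_open_gt/nlip_min_dist.
have KE : \bigcap_j [set x | min_dist s (k j) x <= r j] = ~` (\bigcup_j U j).
  rewrite setC_bigcup; apply: eq_bigcapr => j _; apply/seteqP; split=> x /=.
    by rewrite leNgt => /negP.
  by move/negP; rewrite -leNgt.
exists (\bigcap_j [set x | min_dist s (k j) x <= r j]); split.
- apply: compact_min_dist => d d0; exists (Num.truncn d^-1).
  rewrite -[ltRHS]invrK ltf_pV2 ?posrE ?invr_gt0// ?ltr0n ?expn_gt0//.
  apply: lt_trans (truncnS_gt _) _; rewrite ltr_nat; exact: ltn_expl.
- by rewrite KE; apply: measurableC; exact: bigcup_measurable.
- move=> n; rewrite KE setCK.
  apply: le_trans (generalized_Boole_inequality (mu n) mU _) _.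
    exact: bigcup_measurable.
  apply: (@le_trans _ _ (\sum_(j <oo) (e / (2 ^ j.+1)%:R)%:E)%E); last first.
    by apply: (@epsilon_trick0 _ e xpredT); exact: ltW.
  apply: lee_nneseries => // j _.
  have nmd := nlip_min_dist s (k j).
  have rV : 0 <= (r j)^-1 by rewrite invr_ge0 ltW.
  apply: (@le_trans _ _ (\int[mu n]_x ((r j)^-1 * min_dist s (k j) x)%:E)%E).
    apply: measure_le_integral => //; first exact: nlipZ.
    by move=> x /ltW rx; rewrite mulrC ler_pdivlMr// mul1r.
  rewrite nlip_intE//; last exact: nlipZ.
  rewrite lee_fin nlip_intZ// mulrC ler_pdivrMr//; exact: kP.
Qed.

Definition weak_lim f := limn (fun n => nlip_int (mu n) f).

Lemma weak_lim_cvg f : nlip f -> nlip_int (mu n) f @[n --> \oo] --> weak_lim f.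
Proof.
move=> nf; suff : cvgn (fun n => nlip_int (mu n) f) by [].
apply: cauchy_cvg; apply: cauchy_exP => e e0.
have [f0 [C C0 fC]] := nf; have C1 : 0 < C + 1 by rewrite ltr_wpDl.
have [|N NP] := @mu_cauchy (e / 2 / (C + 1)); first by rewrite !divr_gt0.
pose g x := (C + 1)^-1 * f x.
have CV : 0 <= (C + 1)^-1 by rewrite invr_ge0 ltW.
have ng : nlip g by apply: nlipZ.
have g1 : lip_with 1 g.
  move=> x y; rewrite /g mul1r ler_pdivrMl// mulrDr mulrA divff ?lt0r_neq0// mul1r.
  by have := fC x y; have := mdist_ge0 x y; lra.
have fE n : nlip_int (mu n) f = (C + 1) * nlip_int (mu n) g.
  by rewrite nlip_intZ// mulrA divff ?lt0r_neq0// mul1r.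
have dE : (C + 1) * (e / 2 / (C + 1)) = e / 2 by field; rewrite lt0r_neq0.
exists (nlip_int (mu N) f); exists N => // n /= Nn; rewrite /ball/= !fE.
have h1 := NP n N Nn (leqnn N) g ng g1.
have h2 := NP N n (leqnn N) Nn g ng g1.
rewrite -mulrBr normrM gtr0_norm//.
apply: (@le_lt_trans _ _ ((C + 1) * (e / 2 / (C + 1)))).
  by rewrite ler_pM2l// ler_norml; lra.
by rewrite dE; lra.
Qed.

(** The limit functional is represented by [daniell]. Its continuity along
    increasing sequences h k that reach 1 everywhere is where completeness of
    E enters: a compact set of mass at least 1 - e for all mu n lies, by
    compactness, in a single open set {h k > 1 - e}. *)
Lemma weak_completeness : exists pi : probability (borel E) R,
  forall f, nlip f -> (forall x, f x <= 1) ->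
  nlip_int (mu n) f @[n --> \oo] --> nlip_int pi f.
Proof.
have [] := @daniell _ _ dist_le1 E_separable weak_lim.
- move=> f nf; apply: limr_ge; first by apply/cvg_ex; eexists; exact: weak_lim_cvg.
  by apply: nearW => n; exact: nlip_int_ge0.
- move=> f g nf ng; apply/cvg_lim => //.
  under eq_fun do rewrite nlip_intD//.
  by apply: cvgD; exact: weak_lim_cvg.
- move=> c f c0 nf; apply/cvg_lim => //.
  under eq_fun do rewrite nlip_intZ//.
  by apply: cvgM; [exact: cvg_cst|exact: weak_lim_cvg].
- apply/cvg_lim => //; under eq_fun do rewrite nlip_int_cst//.
  exact: cvg_cst.
- move=> h c nh ndh Lh h1.
  have Lh_ge (e : R) : 0 < e -> e < 1 -> (1 - e) * (1 - e) <= c.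
    move=> e0 e1; have [K [cK mK muK]] := uniformly_tight e0.
    have [k hk] : exists k, forall x, K x -> 1 - e < h k x.
      move: cK; rewrite compact_cover => /(_ nat setT (fun k => [set x | 1 - e < h k x])).
      case=> [k _|x Kx|D _ KD]; first exact: nlip_open_gt.
        by have [k hk] := h1 x; exists k => //=; apply: lt_le_trans hk; lra.
      exists (\max_(k <- finmap.enum_fset D) k)%N => x /KD[k /= kD hkx].
      by apply: lt_le_trans hkx _; apply: ndh; exact: leq_bigmax_seq.
    apply: le_trans (Lh k); apply: limr_ge.
      by apply/cvg_ex; eexists; exact: weak_lim_cvg.
    apply: nearW => n; rewrite -lee_fin -nlip_intE//.
    have e1' : 0 < 1 - e by lra.
    have eV : 0 <= (1 - e)^-1 by rewrite invr_ge0 ltW.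
    have muK' : ((1 - e)%:E <= mu n K)%E.
      have KKC : (mu n K + mu n (~` K) = 1)%E.
        have := measureU (mu n) mK (measurableC mK) (setICr K).
        by rewrite setUCr => <-; exact: muT.
      by rewrite EFinB leeBlDr// -KKC leeD2l.
    have : ((1 - e)%:E <= \int[mu n]_x ((1 - e)^-1 * h k x)%:E)%E.
      apply: le_trans muK' _; apply: measure_le_integral => //; first exact: nlipZ.
      by move=> x /hk hx; rewrite mulrC ler_pdivlMr// mul1r ltW.
    rewrite !nlip_intE//; last exact: nlipZ.
    by rewrite nlip_intZ// !lee_fin ler_pdivlMl.
  rewrite leNgt; apply/negP => c1.
  have c0 : 0 <= c.
    apply: le_trans (Lh 0%N); apply: limr_ge.
      by apply/cvg_ex; eexists; exact: weak_lim_cvg.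
    by apply: nearW => n; exact: nlip_int_ge0.
  (* With e = (1 - c) / 4 one has (1 - e) ^ 2 > c. *)
  by have := Lh_ge ((1 - c) / 4); nra.
move=> pi piP; exists pi => f nf f1.
have -> : nlip_int pi f = weak_lim f by rewrite /nlip_int piP.
exact: weak_lim_cvg.
Qed.

End weak_completeness.

(** * Contraction under a drift condition *)

Section iterated_kernel.
Context d (T : measurableType d) (R : realType).
Implicit Types (K : R.-pker T ~> T).

(** All the integrals below are of nonnegative functions with values in the
    extended reals, so additivity and homogeneity hold without integrability
    conditions; they are only ever used through this inequality. *)
Lemma integral_le_comb (m : {measure set T -> \bar R}) (f u w : T -> \bar R) (a k : R) :
  0 <= a -> 0 <= k ->
  (forall x, 0 <= f x)%E -> (forall x, 0 <= u x)%E -> (forall x, 0 <= w x)%E ->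
  measurable_fun setT f -> measurable_fun setT u -> measurable_fun setT w ->
  (forall x, f x <= a%:E * u x + k%:E * w x)%E ->
  (\int[m]_x f x <= a%:E * (\int[m]_x u x) + k%:E * (\int[m]_x w x))%E.
Proof.
move=> a0 k0 f0 u0 w0 mf mu mw fuw.
have au0 x : (0 <= a%:E * u x)%E by rewrite mule_ge0// lee_fin.
have kw0 x : (0 <= k%:E * w x)%E by rewrite mule_ge0// lee_fin.
have mau : measurable_fun setT (fun x => a%:E * u x)%E by exact: measurable_funeM.
have mkw : measurable_fun setT (fun x => k%:E * w x)%E by exact: measurable_funeM.
rewrite -!ge0_integralZl// -ge0_integralD//.
by apply: ge0_le_integral => //; exact: emeasurable_funD.
Qed.

Lemma iter_kernel_apply_ge0 K n f :
  (forall x, 0 <= f x)%E -> (forall x, 0 <= iter n (kernel_apply K) f x)%E.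
Proof. by move=> f0; elim: n => //= n IHn; exact: kernel_apply_ge0. Qed.

Lemma measurable_iter_kernel_apply K n f :
  (forall x, 0 <= f x)%E -> measurable_fun setT f ->
  measurable_fun setT (iter n (kernel_apply K) f).
Proof.
move=> f0 mf; elim: n => [//|n IHn]; rewrite iterS.
by apply: measurable_kernel_apply => // x; exact: iter_kernel_apply_ge0.
Qed.

Lemma kernel_apply_cst K (c : R) : kernel_apply K (cst c%:E) = cst c%:E.
Proof.
apply/funext => x; rewrite /kernel_apply integral_cst//.
by rewrite prob_kernel mule1.
Qed.

Lemma iter_kernel_apply_cst K n (c : R) : iter n (kernel_apply K) (cst c%:E) = cst c%:E.
Proof. by elim: n => //= n ->; exact: kernel_apply_cst. Qed.

Lemma iter_kernel_apply_comb K n (f u w : T -> \bar R) (a k : R) :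
  0 <= a -> 0 <= k ->
  (forall x, 0 <= f x)%E -> (forall x, 0 <= u x)%E -> (forall x, 0 <= w x)%E ->
  measurable_fun setT f -> measurable_fun setT u -> measurable_fun setT w ->
  (forall x, f x <= a%:E * u x + k%:E * w x)%E ->
  forall x, (iter n (kernel_apply K) f x <=
    a%:E * iter n (kernel_apply K) u x + k%:E * iter n (kernel_apply K) w x)%E.
Proof.
move=> a0 k0 f0 u0 w0 mf mu mw fuw x.
by rewrite -!kernel_apply_iter//; exact: integral_le_comb.
Qed.

Lemma kernel_apply_comb K (f u w : T -> \bar R) (a k : R) :
  0 <= a -> 0 <= k ->
  (forall x, 0 <= f x)%E -> (forall x, 0 <= u x)%E -> (forall x, 0 <= w x)%E ->
  measurable_fun setT f -> measurable_fun setT u -> measurable_fun setT w ->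
  (forall x, f x <= a%:E * u x + k%:E * w x)%E ->
  forall x, (kernel_apply K f x <= a%:E * kernel_apply K u x + k%:E * kernel_apply K w x)%E.
Proof. by move=> ? ? ? ? ? ? ? ? ? x; exact: integral_le_comb. Qed.

Lemma iter_kernel_apply_le K n (f g : T -> \bar R) :
  (forall x, 0 <= f x)%E -> measurable_fun setT f -> measurable_fun setT g ->
  (forall x, f x <= g x)%E ->
  forall x, (iter n (kernel_apply K) f x <= iter n (kernel_apply K) g x)%E.
Proof.
move=> f0 mf mg fg x; have g0 y : (0 <= g y)%E by exact: le_trans (fg y).
by rewrite -!kernel_apply_iter//; exact: ge0_le_integral.
Qed.

End iterated_kernel.

Section drift_contraction.
Context d (T : measurableType d) (R : realType).
Variables (Q : R.-pker T ~> T) (D : set T) (l : nat) (dst W : T -> R) (eps b c : R).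
Hypotheses (dst_ge0 : forall z, 0 <= dst z) (dst_le1 : forall z, dst z <= 1).
Hypothesis mdst : measurable_fun setT dst.
Hypotheses (W_ge1 : forall z, 1 <= W z) (mW : measurable_fun setT W).
Hypotheses (eps_le1 : eps <= 1) (c_gt0 : 0 < c) (b_ge0 : 0 <= b).
Let Qd n z := iter n (kernel_apply Q) (EFin \o dst) z.
Hypothesis Q_nonexp : forall z, (Qd 1 z <= (dst z)%:E)%E.
Hypothesis Q_contr : forall z, D z -> (Qd l z <= ((1 - eps) * dst z)%:E)%E.
Hypothesis Q_drift : forall z,
  (kernel_apply Q (EFin \o W) z <= (W z - c + b * \1_D z)%:E)%E.

Let dst0 z : (0 <= (EFin \o dst) z)%E. Proof. by rewrite lee_fin. Qed.
Let W0 z : (0 <= (EFin \o W) z)%E. Proof. by rewrite lee_fin (le_trans ler01). Qed.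
Let mdstE : measurable_fun setT (EFin \o dst). Proof. exact/measurable_EFinP. Qed.
Let mWE : measurable_fun setT (EFin \o W). Proof. exact/measurable_EFinP. Qed.
Let Qd0 n z : (0 <= Qd n z)%E. Proof. exact: iter_kernel_apply_ge0. Qed.
Let mQd n : measurable_fun setT (Qd n). Proof. exact: measurable_iter_kernel_apply. Qed.

Lemma iter_dst_le1 n z : (Qd n z <= 1)%E.
Proof.
have -> : 1%E = iter n (kernel_apply Q) (cst 1%E) z by rewrite iter_kernel_apply_cst.
by apply: iter_kernel_apply_le => // x; rewrite lee_fin.
Qed.

Lemma iter_drift n z :
  (iter n (kernel_apply Q) (EFin \o W) z <= (W z + b * n%:R)%:E)%E.
Proof.
elim: n z => [|n IHn] z; first by rewrite mulr0 addr0.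
rewrite iterS.
have bn0 : 0 <= b * n%:R by rewrite mulr_ge0.
have := @kernel_apply_comb _ _ _ Q (iter n (kernel_apply Q) (EFin \o W))
  (EFin \o W) (cst 1%E) 1 (b * n%:R) ler01 bn0.
move=> /(_ _ W0 _ _ mWE _ _ z)/le_trans -> //.
- exact: iter_kernel_apply_ge0.
- exact: measurable_iter_kernel_apply.
- by move=> x; rewrite mul1e mule1 -EFinD.
rewrite mul1e kernel_apply_cst mule1.
apply: (@le_trans _ _ ((W z + b)%:E + (b * n%:R)%:E)%E); last first.
  by rewrite -EFinD lee_fin -natr1 mulrDr mulr1; lra.
rewrite leeD2r//; apply: le_trans (Q_drift z) _; rewrite lee_fin.
have : b * \1_D z <= b by rewrite indicE; case: (z \in D); rewrite ?mulr1 ?mulr0.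
have := c_gt0; lra.
Qed.

(** The target of the induction: a fraction theta of the initial distance
    survives, up to an error which is Markov's bound, of order W / n, on the
    probability that the visits to D have been too few during the first n
    steps. *)
Definition contracts (theta : R) := exists2 K, 0 <= K & forall n z,
  (Qd n.+1 z <= (theta * dst z + K * W z / n.+1%:R)%:E)%E.

Lemma contracts1 : contracts 1.
Proof.
exists 0 => // n z; rewrite mul0r mul0r addr0 mul1r.
elim: n => [|n IHn] //.
apply: le_trans IHn; rewrite /Qd iterSr.
apply: iter_kernel_apply_le => //.
- exact: (Qd0 1).
- exact: (mQd 1).
Qed.

(** One more visit to D gains one more factor 1 - eps. Rather than decomposing
    at the hitting time of D, it is enough that the right-hand side is a
    supersolution: on D the old bound applies after l steps, and off D the
    error K2 * W / n dominates its own image by Q from time n - 1, because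
    there W decreases by c on average. Where W > c * n this last comparison
    fails, but then the error exceeds 1, which bounds the distance. *)
Lemma contracts_step theta : 0 <= theta -> contracts theta ->
  contracts (theta * (1 - eps)).
Proof.
move=> th0 [K K0 HK].
have e10 : 0 <= 1 - eps by rewrite subr_ge0.
have the0 : 0 <= theta * (1 - eps) by exact: mulr_ge0.
(* K' absorbs the growth of W over l steps (W + b l <= W (1 + b l) as W >= 1)
   and the passage from 1 / M to 1 / (l + M). *)
pose K' := K * (1 + b * l%:R) * (1 + l%:R).
pose K2 := 1 + c^-1 + l%:R + K'.
have ci0 : 0 < c^-1 by rewrite invr_gt0.
have bl0 : 0 <= b * l%:R by rewrite mulr_ge0.
have l0 : 0 <= l%:R :> R by [].
have K'0 : 0 <= K' by rewrite /K' !mulr_ge0// addr_ge0.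
have K20 : 0 <= K2 by rewrite /K2; lra.
exists K2 => //.
(* Distances are at most 1, so there is nothing to prove when n <= K2 * W z. *)
have trivial n z : n%:R <= K2 * W z -> (0 < n)%N ->
    (Qd n z <= (theta * (1 - eps) * dst z + K2 * W z / n%:R)%:E)%E.
  move=> nKW n0; apply: le_trans (iter_dst_le1 n z) _; rewrite lee_fin.
  have : 1 <= K2 * W z / n%:R by rewrite ler_pdivlMr ?mul1r// ltr0n.
  have : 0 <= theta * (1 - eps) * dst z by rewrite mulr_ge0.
  lra.
have W1 z : 0 <= W z by rewrite (le_trans ler01).
elim=> [|n IHn] z.
  apply: trivial => //; apply: le_trans (W_ge1 z) _.
  by rewrite ler_peMl//; rewrite /K2; lra.
have [zD|zD] := pselect (D z).
  have [nl|ln] := leqP n.+2 l.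
    apply: trivial => //; apply: (@le_trans _ _ l%:R); first by rewrite ler_nat.
    by have : l%:R <= K2; [rewrite /K2; lra|have := W_ge1 z; nra].
  have [M nE] : exists M, n.+2 = (l + M.+1)%N.
    by exists (n.+1 - l)%N; rewrite -subSn// subnKC// ltnW.
  have M0 : 0 <= K / M.+1%:R by rewrite divr_ge0.
  have := @iter_kernel_apply_comb _ _ _ Q l (Qd M.+1) (EFin \o dst) (EFin \o W)
    theta (K / M.+1%:R) th0 M0 (Qd0 _) dst0 W0 (mQd _) mdstE mWE.
  have HKM x : (Qd M.+1 x <= theta%:E * (EFin \o dst) x + (K / M.+1%:R)%:E * (EFin \o W) x)%E.
    by rewrite -!EFinM -EFinD mulrAC.
  move=> /(_ HKM z); rewrite -[X in (X <= _)%E]/(iter l _ (iter M.+1 _ _) z) -iterD -nE.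
  move=> /le_trans; apply.
  apply: (@le_trans _ _ (theta%:E * ((1 - eps) * dst z)%:E +
      (K / M.+1%:R)%:E * (W z + b * l%:R)%:E)%E).
    by apply: leeD; apply: lee_pmul => //; rewrite ?lee_fin//;
      [exact: (Qd0 l)|exact: Q_contr|exact: iter_kernel_apply_ge0|exact: iter_drift].
  rewrite -!EFinM -EFinD lee_fin mulrA lerD2l nE.
  have M1 : 0 < M.+1%:R :> R by [].
  have lM : 0 < (l + M.+1)%:R :> R by rewrite ltr0n addnS.
  rewrite mulrAC ler_pdivrMr// mulrAC ler_pdivlMr//.
  apply: (@le_trans _ _ (K' * W z * M.+1%:R)); last first.
    by rewrite ler_pM2r// ler_wpM2r//; rewrite /K2; lra.
  have h1 : W z + b * l%:R <= W z * (1 + b * l%:R) by have := W_ge1 z; nra.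
  have h2 : (l + M.+1)%:R <= (1 + l%:R) * M.+1%:R :> R.
    have : 1 <= M.+1%:R :> R by rewrite ler1n.
    rewrite natrD; nra.
  rewrite (_ : K' * W z * M.+1%:R =
    K * (W z * (1 + b * l%:R)) * ((1 + l%:R) * M.+1%:R)); last by rewrite /K'; ring.
  apply: ler_pM => //; first by rewrite mulr_ge0// addr_ge0.
  by apply: ler_wpM2l.
have [Wn|nW] := leP (W z) (c * n.+2%:R); last first.
  apply: trivial => //; move/ltW : nW; rewrite mulrC -ler_pdivlMr// => /le_trans; apply.
  by rewrite mulrC ler_wpM2r//; rewrite /K2; lra.
have K2n : 0 <= K2 / n.+1%:R by rewrite divr_ge0.
have := @kernel_apply_comb _ _ _ Q (Qd n.+1) (EFin \o dst) (EFin \o W)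
    (theta * (1 - eps)) (K2 / n.+1%:R) the0 K2n (Qd0 _) dst0 W0 (mQd _) mdstE mWE.
have HKM x : (Qd n.+1 x <=
    (theta * (1 - eps))%:E * (EFin \o dst) x + (K2 / n.+1%:R)%:E * (EFin \o W) x)%E.
  by rewrite -!EFinM -EFinD [K2 / _ * _]mulrAC; exact: IHn.
move=> /(_ HKM z) /le_trans; apply.
apply: (@le_trans _ _ ((theta * (1 - eps))%:E * (dst z)%:E +
    (K2 / n.+1%:R)%:E * (W z - c)%:E)%E).
  apply: leeD; apply: lee_pmul => //; rewrite ?lee_fin//.
  - exact: (Qd0 1).
  - exact: Q_nonexp.
  - exact: kernel_apply_ge0.
  - apply: le_trans (Q_drift z) _.
    by rewrite lee_fin indicE memNset// mulr0 addr0.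
rewrite -!EFinM -EFinD lee_fin lerD2l.
rewrite mulrAC ler_pdivrMr// mulrAC ler_pdivlMr//.
rewrite -!mulrA ler_wpM2l//.
by move: Wn; rewrite -[n.+2%:R]natr1; have := W_ge1 z; nra.
Qed.

(** Iterating [contracts_step]: the mean distance after n steps tends to 0,
    uniformly on the sublevel sets of W. *)
Lemma drift_contraction m : exists2 K, 0 <= K & forall n z,
  (Qd n.+1 z <= ((1 - eps) ^+ m + K * W z / n.+1%:R)%:E)%E.
Proof.
have e10 : 0 <= 1 - eps by rewrite subr_ge0.
have [K K0 HK] : contracts ((1 - eps) ^+ m).
  elim: m => [|m IHm]; first by rewrite expr0; exact: contracts1.
  by rewrite exprSr; apply: contracts_step => //; exact: exprn_ge0.
exists K => // n z; apply: le_trans (HK n z) _.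
by rewrite lee_fin lerD2r ler_piMr// exprn_ge0.
Qed.

End drift_contraction.

(** * Moment bounds from a drift condition *)

Section foster_drift.
Context d (T : measurableType d) (R : realType).
Variables (K : R.-pker T ~> T) (W f : T -> R) (B : R).
Hypotheses (W_ge0 : forall x, 0 <= W x) (mW : measurable_fun setT W).
Hypotheses (f_ge0 : forall x, 0 <= f x) (mf : measurable_fun setT f).
Hypothesis B_ge0 : 0 <= B.
Hypothesis K_drift : forall x,
  (kernel_apply K (EFin \o W) x + (f x)%:E <= (W x + B)%:E)%E.

Let W0 x : (0 <= (EFin \o W) x)%E. Proof. by rewrite lee_fin. Qed.
Let f0 x : (0 <= (EFin \o f) x)%E. Proof. by rewrite lee_fin. Qed.
Let mWE : measurable_fun setT (EFin \o W). Proof. exact/measurable_EFinP. Qed.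
Let mfE : measurable_fun setT (EFin \o f). Proof. exact/measurable_EFinP. Qed.

Lemma foster_sum_le N x :
  (\sum_(k < N) iter k (kernel_apply K) (EFin \o f) x <= (W x + B * N%:R)%:E)%E.
Proof.
suff H : (\sum_(k < N) iter k (kernel_apply K) (EFin \o f) x +
    iter N (kernel_apply K) (EFin \o W) x <= (W x + B * N%:R)%:E)%E.
  apply: le_trans H; rewrite leeDl//; exact: iter_kernel_apply_ge0.
elim: N => [|N IHN]; first by rewrite big_ord0 add0e mulr0 addr0.
have KW0 y : (0 <= kernel_apply K (EFin \o W) y)%E by exact: kernel_apply_ge0.
have mKW : measurable_fun setT (kernel_apply K (EFin \o W)).
  exact: measurable_kernel_apply.
have step : (iter N (kernel_apply K) (EFin \o f) x +
    iter N.+1 (kernel_apply K) (EFin \o W) x <=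
    iter N (kernel_apply K) (EFin \o W) x + B%:E)%E.
  rewrite iterSr -!kernel_apply_iter// /kernel_apply -ge0_integralD//; last first.
    by move=> y _; exact: KW0.
  have -> : B%:E = (\int[kernel_iter K N x]_z (cst B%:E z))%E.
    rewrite -[RHS]/(kernel_apply (kernel_iter K N) (cst B%:E) x).
    by rewrite kernel_apply_iter ?iter_kernel_apply_cst// => y; rewrite lee_fin.
  rewrite -ge0_integralD//.
  apply: ge0_le_integral => //.
  - by move=> y _; apply: adde_ge0; [exact: f0|exact: KW0].
  - exact: emeasurable_funD.
  - exact: emeasurable_funD.
  - by move=> y _; rewrite addeC; exact: K_drift.
rewrite big_ord_recr/= -addeA.
apply: le_trans (leeD2l _ step) _.
by rewrite addeA -natr1 mulrDr mulr1 addrA EFinD leeD2r.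
Qed.

(** W need not be integrable, so the drift inequality is truncated: as
    W_n = min(W, n) satisfies K W_n <= min(K W, n), one has
    K W_n + f 1_{W <= n} <= W_n + B. The integrals of W_n and K W_n are finite
    and equal; cancel them and let n tend to infinity. *)
Lemma foster_invariant (pi : probability T R) : invariant_probability K pi ->
  (\int[pi]_x (f x)%:E <= B%:E)%E.
Proof.
move=> Kpi.
pose A (n : nat) := [set x | W x <= n%:R].
have mA n : measurable (A n).
  have -> : A n = W @^-1` `]-oo, n%:R]%classic.
    by apply/seteqP; split=> x /=; rewrite in_itv.
  by rewrite -[X in measurable X]setTI; exact: mW.
have ndA : nondecreasing_seq A.
  by move=> m n mn; apply/subsetPset => x /=; move/le_trans; apply; rewrite ler_nat.
have cupA : \bigcup_n A n = setT.
  apply/seteqP; split => // x _; exists (Num.truncn (W x)).+1 => //=.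
  exact/ltW/truncnS_gt.
have f_A n : (\int[pi]_(x in A n) (f x)%:E <= B%:E)%E.
  pose Wn x := Num.min (W x) n%:R.
  have Wn0 x : (0 <= (EFin \o Wn) x)%E by rewrite lee_fin le_min W_ge0/=.
  have mWn : measurable_fun setT (EFin \o Wn).
    by apply/measurable_EFinP; exact: measurable_minr.
  have intWn_fin : (\int[pi]_x (EFin \o Wn) x)%E \is a fin_num.
    rewrite ge0_fin_numE; last exact: integral_ge0.
    apply: (@le_lt_trans _ _ (\int[pi]_(x in setT) (n%:R)%:E)%E).
      apply: ge0_le_integral => //.
      by move=> x _; rewrite lee_fin ge_min lexx orbT.
    by rewrite integral_cst// [X in (_ * X)%E]probability_setT mule1 ltry.
  have fA0 x : (0 <= ((EFin \o f) \_ (A n)) x)%E by apply: erestrict_ge0.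
  have mfA : measurable_fun setT ((EFin \o f) \_ (A n)).
    by apply/(measurable_restrictT _ _).1 => //; exact: measurable_funTS.
  have KWn0 x : (0 <= kernel_apply K (EFin \o Wn) x)%E by exact: kernel_apply_ge0.
  have drift_n x : (kernel_apply K (EFin \o Wn) x + ((EFin \o f) \_ (A n)) x <=
      (EFin \o Wn) x + B%:E)%E.
    have [xA|xA] := boolP (x \in A n).
      rewrite patchE xA; move: xA; rewrite inE => xA.
      have -> : (EFin \o Wn) x = (W x)%:E by rewrite /= /Wn min_l.
      apply: le_trans (K_drift x); rewrite leeD2r//.
      by apply: ge0_le_integral => // y _; rewrite lee_fin ge_min lexx.
    rewrite patchE (negbTE xA) adde0.
    have -> : (EFin \o Wn) x = (n%:R)%:E.
      rewrite /= /Wn min_r//; move: xA; rewrite notin_setE/= => /negP.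
      by rewrite -ltNge => /ltW.
    apply: (@le_trans _ _ (n%:R)%:E); last by rewrite leeDl// lee_fin.
    rewrite -[leRHS]/(cst (n%:R)%:E x) -(kernel_apply_cst K n%:R).
    by apply: ge0_le_integral => // y _; rewrite lee_fin ge_min lexx orbT.
  rewrite integral_mkcond -(leeD2lE _ _ intWn_fin) -{1}(invariant_integral Kpi Wn0 mWn).
  rewrite -ge0_integralD//; last exact: measurable_kernel_apply.
  have -> : B%:E = (\int[pi]_x (cst B%:E x))%E.
    by rewrite integral_cst// [X in (_ * X)%E]probability_setT mule1.
  rewrite -ge0_integralD//.
  apply: ge0_le_integral => //.
  - by move=> y _; rewrite adde_ge0.
  - by apply: emeasurable_funD => //; exact: measurable_kernel_apply.
  - exact: emeasurable_funD.
have := @ge0_nondecreasing_set_cvg_integral _ _ _ A (EFin \o f) pi ndA mA.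
rewrite cupA => H.
have {}H := H (fun i => measurable_funTS mfE) (fun _ x _ => f0 x).
rewrite -(cvg_lim _ H)//; apply: lime_le; first by apply/cvg_ex; eexists; exact: H.
exact: nearW.
Qed.

End foster_drift.

Section rate_class.
Context (R : realType) (phi : R -> R).
Hypothesis phi_class : subgeometric_rate_class phi.

Lemma rate_ge0 x : 0 <= x -> 0 <= phi x.
Proof. by case: phi_class => + _ _ _ _; exact. Qed.

Lemma rate_le x y : 0 <= x -> x <= y -> phi x <= phi y.
Proof.
case: phi_class => _ _ phi_nd _ _ x0 xy; apply: phi_nd => //.
  by rewrite in_itv/= x0.
by rewrite in_itv/= (le_trans x0).
Qed.

Lemma rate_unbounded A : exists2 M, 0 < M & A < phi M.
Proof.
case: phi_class => _ _ _ /cvgryPgt/(_ A)[M [_ HM]] _.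
exists (Num.max M 0 + 1); first by rewrite ltr_wpDl// le_max lexx orbT.
by apply: HM; rewrite ltr_pwDr// le_max lexx.
Qed.

(** Concavity between 0 and a point M where phi is positive. *)
Lemma rate_gt0 x : 0 < x -> 0 < phi x.
Proof.
move=> x0; have [M M0 phiM] := rate_unbounded 0.
have [Mx|xM] := leP M x; first exact: lt_le_trans phiM (rate_le (ltW M0) Mx).
have t01 : 0 <= x / M <= 1.
  by rewrite divr_ge0 ?(ltW x0) ?(ltW M0)//= ler_pdivrMr// mul1r ltW.
have /andP[t0 t1] := t01.
case: phi_class => _ phi_cvx _ _ _.
have H : - phi (x / M * M + (1 - x / M) * 0) <=
    x / M * - phi M + (1 - x / M) * - phi 0.
  by apply: (phi_cvx (Itv01 t0 t1) M 0); rewrite inE/= in_itv/= ?lexx ?(ltW M0).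
move: H; rewrite mulr0 addr0 divfK ?lt0r_neq0// => H.
have p0 : 0 <= phi 0 by exact: rate_ge0.
have : 0 < x / M * phi M by rewrite mulr_gt0// divr_gt0.
have : 0 <= (1 - x / M) * phi 0 by rewrite mulr_ge0// subr_ge0.
move: H; rewrite !mulrN; lra.
Qed.

Lemma measurable_rate d (T : measurableType d) (V : T -> R) :
  (forall x, 0 <= V x) -> measurable_fun setT V ->
  measurable_fun setT (fun x => phi (V x)).
Proof.
move=> V0 mV.
(* phi is monotone on the nonnegative reals only. *)
pose psi t := phi (Num.max t 0).
have -> : (fun x => phi (V x)) = psi \o V.
  by apply/funext => x; rewrite /psi /= max_l.
apply: measurableT_comp => //; apply: nondecreasing_measurable => // s t st.
by apply: rate_le; [rewrite le_max lexx orbT|rewrite ge_max !le_max st lexx orbT].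
Qed.

End rate_class.

(** * Couplings of a kernel *)

Section coupling.
Context (R : realType) (E : completeMetricType R).
Variables (P : R.-pker (borel E) ~> (borel E))
  (Q : R.-pker (borel (E * E)%type) ~> (borel (E * E)%type)).
Hypothesis Q_coupling : coupling_kernel P Q.

Lemma measurable_fst_borel :
  measurable_fun setT (fst : borel (E * E)%type -> borel E).
Proof.
apply: (@measurability _ _ _ (borel E) _ _ (@open E)) => [|A [B oB <-{A}]] //; rewrite setTI.
apply: sub_sigma_algebra; rewrite /= openE => z Bz.
have /nbhs_ballP[e e0 eB] : nbhs z.1 B by apply: open_nbhs_nbhs.
by apply/nbhs_ballP; exists e => // w [zw _]; exact: eB.
Qed.

Lemma measurable_snd_borel :
  measurable_fun setT (snd : borel (E * E)%type -> borel E).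
Proof.
apply: (@measurability _ _ _ (borel E) _ _ (@open E)) => [|A [B oB <-{A}]] //; rewrite setTI.
apply: sub_sigma_algebra; rewrite /= openE => z Bz.
have /nbhs_ballP[e e0 eB] : nbhs z.2 B by apply: open_nbhs_nbhs.
by apply/nbhs_ballP; exists e => // w [_ zw]; exact: eB.
Qed.

Definition pair_dist (z : borel (E * E)%type) : R := @mdist R E z.1 z.2.

Lemma measurable_pair_dist : measurable_fun setT pair_dist.
Proof.
apply: measurable_fun_generator => r; rewrite /pair_dist openE => z /= rz.
apply/nbhs_ballP; exists ((mdist z.1 z.2 - r) / 2) => [|w [/=]].
  by rewrite /= divr_gt0// subr_gt0.
rewrite !ballEmdist/= => h1 h2.
have := metric_triangle z.1 w.1 z.2; have := metric_triangle w.1 w.2 z.2.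
by rewrite (metric_sym w.2 z.2); lra.
Qed.

Lemma coupling_fst (f : borel E -> \bar R) x y :
  (forall u, 0 <= f u)%E -> measurable_fun setT f ->
  kernel_apply Q (fun z => f z.1) (x, y) = kernel_apply P f x.
Proof.
move=> f0 mf; rewrite /kernel_apply.
have := @ge0_integral_pushforward _ _ _ _ R _ measurable_fst_borel (Q (x, y)) setT f.
rewrite preimage_setT => <-//.
apply: eq_measure_integral => [|? A mA _]; first exact: measurable_fst_borel.
exact: (Q_coupling x y mA).1.
Qed.

Lemma coupling_snd (f : borel E -> \bar R) x y :
  (forall u, 0 <= f u)%E -> measurable_fun setT f ->
  kernel_apply Q (fun z => f z.2) (x, y) = kernel_apply P f y.
Proof.
move=> f0 mf; rewrite /kernel_apply.
have := @ge0_integral_pushforward _ _ _ _ R _ measurable_snd_borel (Q (x, y)) setT f.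
rewrite preimage_setT => <-//.
apply: eq_measure_integral => [|? A mA _]; first exact: measurable_snd_borel.
exact: (Q_coupling x y mA).2.
Qed.

Definition coupled_dist n x y : \bar R :=
  iter n (kernel_apply Q) (EFin \o pair_dist) (x, y).

Let dE z : (0 <= (EFin \o pair_dist) z)%E.
Proof. by rewrite lee_fin mdist_ge0. Qed.
Let mdE : measurable_fun setT (EFin \o pair_dist).
Proof. by apply/measurable_EFinP; exact: measurable_pair_dist. Qed.

Lemma coupled_dist_ge0 n x y : (0 <= coupled_dist n x y)%E.
Proof. exact: iter_kernel_apply_ge0. Qed.

(** Both marginals of the coupled chain are chains with kernel P, so the
    difference of the two expectations is the expectation of a difference. *)
Lemma iter_lip (f : E -> R) C n x y : 0 <= C -> nlip f -> lip_with C f ->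
  (iter n (kernel_apply P) (EFin \o f) x <=
   iter n (kernel_apply P) (EFin \o f) y + C%:E * coupled_dist n x y)%E.
Proof.
move=> C0 nf fC; have f0 u : (0 <= (EFin \o f) u)%E by rewrite lee_fin; have [] := nf.
have mf : measurable_fun [set: borel E] (EFin \o f).
  by apply/measurable_EFinP; exact: measurable_nlip.
elim: n x y => [|n IHn] x y; first by rewrite /coupled_dist /= -EFinM -EFinD lee_fin.
pose u := iter n (kernel_apply P) (EFin \o f).
have u0 v : (0 <= u v)%E by exact: iter_kernel_apply_ge0.
have mu : measurable_fun setT u by exact: measurable_iter_kernel_apply.
pose h (z : borel (E * E)%type) := iter n (kernel_apply Q) (EFin \o pair_dist) z.
have h0 v : (0 <= h v)%E by exact: iter_kernel_apply_ge0.
have mh : measurable_fun setT h by exact: measurable_iter_kernel_apply.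
rewrite /coupled_dist !iterS -/u -/h.
rewrite -(coupling_fst x y u0 mu) -(coupling_snd x y u0 mu).
rewrite -[X in (_ <= X + _)%E]mul1e.
apply: (@kernel_apply_comb _ _ _ Q (fun z => u z.1) (fun z => u z.2) h 1 C ler01 C0
  (fun z => u0 z.1) (fun z => u0 z.2) h0).
- exact: (measurableT_comp mu measurable_fst_borel).
- exact: (measurableT_comp mu measurable_snd_borel).
- exact: mh.
- by move=> [v w] /=; rewrite mul1e; exact: IHn.
Qed.

End coupling.

(** * Convergence of the laws and the invariant measure *)

(** F is at most A + B on average; comparing sums over k <= j, some k makes both
    F k and F (k + j) comparable to that average. The final 1 makes the
    comparison strict. *)
Lemma pair_below_average (R : realType) (F : nat -> R) (A B : R) :
  0 <= A -> 0 <= B -> (forall k, 0 <= F k) ->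
  (forall N, \sum_(k < N) F k <= A + B * N%:R) ->
  forall j, exists k, F k + F (k + j)%N <= 2 * A + 4 * B + 1.
Proof.
move=> A0 B0 F0 FN j; apply: contrapT => /forallNP noF.
have big k : 2 * A + 4 * B + 1 <= F k + F (k + j)%N.
  by rewrite leNgt; apply/negP => /ltW; exact: noF.
have : \sum_(k < j.+1) (2 * A + 4 * B + 1) <= \sum_(k < j.+1) (F k + F (k + j)%N).
  by apply: ler_sum.
rewrite sumr_const card_ord big_split/= -[_ *+ _]mulr_natr.
have shift : \sum_(k < j.+1) F (k + j)%N <= \sum_(i < j + j.+1) F i.
  rewrite big_split_ord/= [leLHS](_ : _ = \sum_(k < j.+1) F (j + k)%N); last first.
    by apply: eq_bigr => k _; rewrite addnC.
  by rewrite lerDr sumr_ge0.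
have := FN j.+1; have := FN (j + j.+1)%N; rewrite natrD -natr1.
have : 0 <= j%:R :> R by [].
nra.
Qed.

Section wasserstein_ergodicity.
Context (R : realType) (E : completeMetricType R).
Hypothesis E_separable : separable E.
Hypothesis dist_le1 : forall x y : E, mdist x y <= 1.
Variables (P : R.-pker (borel E) ~> (borel E))
  (Q : R.-pker (borel (E * E)%type) ~> (borel (E * E)%type)).
Hypothesis Q_coupling : coupling_kernel P Q.
Variables (V : borel E -> R) (phi : R -> R) (B : R).
Hypotheses (V_meas : measurable_fun setT V) (V_ge1 : forall x, 1 <= V x).
Hypothesis phi_class : subgeometric_rate_class phi.
Hypothesis B_ge0 : 0 <= B.
Hypothesis P_drift : forall x,
  (kernel_apply P (EFin \o (fun x => V x + V x)%R) x + (phi (V x))%:E <=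
   (V x + V x + B)%:E)%E.
Hypothesis coupled_small : forall e M : R, 0 < e -> exists N, forall n,
  (N <= n)%N -> forall x y, V x + V y <= M -> (coupled_dist Q n x y <= e%:E)%E.
Hypothesis coupled_le1 : forall n x y, (coupled_dist Q n x y <= 1)%E.
Hypothesis coupled_le_dist : forall x y, (coupled_dist Q 1 x y <= (mdist x y)%:E)%E.

Let V0 x : 0 <= V x. Proof. exact: le_trans (V_ge1 x). Qed.
Let f_ge0 x : 0 <= phi (V x). Proof. by apply: rate_ge0. Qed.
Let mf : measurable_fun setT (fun x => phi (V x)). Proof. exact: measurable_rate. Qed.
Let VV0 x : 0 <= V x + V x. Proof. exact: addr_ge0. Qed.
Let mVV : measurable_fun setT (fun x => V x + V x). Proof. exact: measurable_funD. Qed.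

Definition law (x : E) (n : nat) : {measure set (borel E) -> \bar R} :=
  kernel_iter P n x.

Lemma lawT x n : law x n setT = 1%E.
Proof.
have <- : iter n (kernel_apply P) (cst 1%:E) x = 1%E by rewrite iter_kernel_apply_cst.
by rewrite -kernel_apply_iter// /kernel_apply integral_cst// mul1e.
Qed.

Lemma nlip_int_law x n f : nlip f ->
  (nlip_int (law x n) f)%:E = iter n (kernel_apply P) (EFin \o f) x.
Proof.
move=> nf; rewrite -(nlip_intE dist_le1 (lawT x n) nf) -kernel_apply_iter//.
- by move=> y; rewrite lee_fin; have [] := nf.
- by apply/measurable_EFinP; exact: measurable_nlip.
Qed.

(** The moments F k = P^k (phi o V) x0 need not be bounded, only their averages
    are. For every k, the means of f at times n and n + k differ by at most
    e / 4 + F k / phi M once n is large: couple the chain started at x0 with the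
    chain started at its own position after k steps, and use Markov's
    inequality on {V > M}. To compare times n and n + j, pass through the later
    time n + j + k, with k from [pair_below_average] chosen so that F k and
    F (k + j) are both controlled. *)
Lemma law_cauchy x0 (e : R) : 0 < e -> exists N, forall m n,
  (N <= m)%N -> (N <= n)%N -> forall f, nlip f -> lip_with 1 f ->
  nlip_int (law x0 m) f <= nlip_int (law x0 n) f + e.
Proof.
move=> e0.
pose F k := fine (iter k (kernel_apply P) (EFin \o (fun x => phi (V x))) x0).
have It0 k : (0 <= iter k (kernel_apply P) (EFin \o (fun x => phi (V x))) x0)%E.
  by apply: iter_kernel_apply_ge0 => x; rewrite lee_fin.
have sumIt N := @foster_sum_le _ _ _ P _ _ B VV0 mVV f_ge0 mf B_ge0 P_drift N x0.
have FE k : iter k (kernel_apply P) (EFin \o (fun x => phi (V x))) x0 = (F k)%:E.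
  rewrite fineK// ge0_fin_numE//.
  have := sumIt k.+1; rewrite big_ord_recr/= => sumIk.
  apply: le_lt_trans (ltry _); apply: le_trans sumIk.
  by rewrite leeDr// sume_ge0.
have F0 k : 0 <= F k by rewrite -lee_fin -FE.
have sumF N : \sum_(k < N) F k <= V x0 + V x0 + B * N%:R.
  by rewrite -lee_fin -sumEFin; under eq_bigr do rewrite -FE; exact: sumIt.
pose C := 2 * (V x0 + V x0) + 4 * B + 1.
have C0 : 0 < C by rewrite /C; have := V0 x0; move: B_ge0; lra.
have [M M0 phiM] := rate_unbounded phi_class (4 * C / e).
have phiM0 : 0 < phi M by apply: lt_trans phiM; rewrite divr_gt0// mulr_gt0.
have CM : C / phi M <= e / 4.
  move: phiM; rewrite ltr_pdivrMr// ler_pdivrMr// => ?; lra.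
have e4 : 0 < e / 4 by rewrite divr_gt0.
have [N NP] := coupled_small (V x0 + M) e4.
pose h y : R := e / 4 + (phi M)^-1 * phi (V y).
have iM0 : 0 <= (phi M)^-1 by rewrite invr_ge0 ltW.
have h0 y : 0 <= h y by apply: addr_ge0; [exact: ltW|exact: mulr_ge0].
have mh : measurable_fun setT h.
  by apply: measurable_funD => //; exact: measurable_funM.
have close n y : (N <= n)%N ->
    (coupled_dist Q n x0 y <= (h y)%:E)%E /\ (coupled_dist Q n y x0 <= (h y)%:E)%E.
  move=> Nn; have [yM|My] := leP (V y) M.
    have eh : ((e / 4)%:E <= (h y)%:E)%E by rewrite lee_fin lerDl mulr_ge0.
    split; apply: le_trans eh; apply: NP => //; first by rewrite lerD2l.
    by rewrite addrC lerD2l.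
  have eh : (1 <= (h y)%:E)%E.
    rewrite lee_fin; apply: (@le_trans _ _ ((phi M)^-1 * phi (V y))); last first.
      by rewrite lerDr ltW.
    rewrite mulrC ler_pdivlMr// mul1r; apply: rate_le => //; exact: ltW.
  by split; apply: le_trans (coupled_le1 _ _ _) eh.
exists N; suff main : forall f, nlip f -> lip_with 1 f -> forall n k, (N <= n)%N ->
    nlip_int (law x0 n) f <= nlip_int (law x0 (n + k)%N) f + (e / 4 + F k / phi M) /\
    nlip_int (law x0 (n + k)%N) f <= nlip_int (law x0 n) f + (e / 4 + F k / phi M).
  have ordered f n j : nlip f -> lip_with 1 f -> (N <= n)%N ->
      nlip_int (law x0 n) f <= nlip_int (law x0 (n + j)%N) f + e /\
      nlip_int (law x0 (n + j)%N) f <= nlip_int (law x0 n) f + e.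
    move=> nf f1 Nn.
    have [k Fk] := pair_below_average (VV0 x0) B_ge0 F0 sumF j.
    have Nnj : (N <= n + j)%N by rewrite (leq_trans Nn)// leq_addr.
    have [] := main f nf f1 n (k + j)%N Nn; have [] := main f nf f1 (n + j)%N k Nnj.
    rewrite -addnA [(j + k)%N]addnC.
    have : F k / phi M + F (k + j)%N / phi M <= C / phi M.
      by rewrite -mulrDl ler_pM2r// invr_gt0.
    lra.
  move=> m n Nm Nn f nf f1; have [mn|/ltnW nm] := leqP m n.
    by have [] := ordered f m (n - m)%N nf f1 Nm; rewrite subnKC.
  by have [] := ordered f n (m - n)%N nf f1 Nn; rewrite subnKC.
move=> f nf f1 n k Nn.
have fE0 y : (0 <= (EFin \o f) y)%E by rewrite lee_fin; have [] := nf.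
have mfE : measurable_fun [set: borel E] (EFin \o f).
  by apply/measurable_EFinP; exact: measurable_nlip.
pose u := iter n (kernel_apply P) (EFin \o f).
have u0 y : (0 <= u y)%E by exact: iter_kernel_apply_ge0.
have mu : measurable_fun setT u by exact: measurable_iter_kernel_apply.
have ux0 : u x0 = (nlip_int (law x0 n) f)%:E by rewrite nlip_int_law.
have Iu : iter k (kernel_apply P) u x0 = (nlip_int (law x0 (n + k)%N) f)%:E.
  by rewrite nlip_int_law// addnC iterD.
have hE0 y : (0 <= (EFin \o h) y)%E by rewrite lee_fin.
have mhE : measurable_fun setT (EFin \o h) by exact/measurable_EFinP.
have Ih : (iter k (kernel_apply P) (EFin \o h) x0 <= (e / 4 + F k / phi M)%:E)%E.
  apply: (@le_trans _ _ ((e / 4)%:E * iter k (kernel_apply P) (cst 1%:E) x0 +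
      (phi M)^-1%:E * iter k (kernel_apply P) (EFin \o (fun x => phi (V x))) x0)%E).
    apply: iter_kernel_apply_comb => //; first exact: ltW.
    - exact/measurable_EFinP.
    - by move=> y; rewrite mule1.
  by rewrite iter_kernel_apply_cst mule1 FE -EFinM -EFinD lee_fin [X in _ + X]mulrC.
have a0 : 0 <= nlip_int (law x0 n) f by apply: nlip_int_ge0 => //; exact: lawT.
have cst0 (y : borel E) : (0 <= cst (nlip_int (law x0 n) f)%:E y)%E by rewrite lee_fin.
split; rewrite -lee_fin EFinD -Iu.
- have -> : (nlip_int (law x0 n) f)%:E =
      iter k (kernel_apply P) (cst (nlip_int (law x0 n) f)%:E) x0.
    by rewrite iter_kernel_apply_cst.
  apply: (@le_trans _ _ (1%:E * iter k (kernel_apply P) u x0 +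
      1%:E * iter k (kernel_apply P) (EFin \o h) x0)%E).
    apply: iter_kernel_apply_comb => // y; rewrite !mul1e /= -ux0.
    apply: le_trans (iter_lip Q_coupling n x0 y ler01 nf f1) _.
    by rewrite mul1e leeD2l//; exact: (close n y Nn).1.
  by rewrite !mul1e leeD2l.
- have -> : (nlip_int (law x0 n) f)%:E =
      iter k (kernel_apply P) (cst (nlip_int (law x0 n) f)%:E) x0.
    by rewrite iter_kernel_apply_cst.
  apply: (@le_trans _ _ (1%:E *
      iter k (kernel_apply P) (cst (nlip_int (law x0 n) f)%:E) x0 +
      1%:E * iter k (kernel_apply P) (EFin \o h) x0)%E).
    apply: iter_kernel_apply_comb => // y; rewrite !mul1e /= -ux0.
    apply: le_trans (iter_lip Q_coupling n y x0 ler01 nf f1) _.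
    by rewrite mul1e leeD2l//; exact: (close n y Nn).2.
  by rewrite !mul1e leeD2l.
Qed.

(** P preserves Lipschitz constants, as Q does not increase the mean distance.
    This Feller-type property is what makes the weak limit invariant. *)
Lemma kernel_apply_nlip f : nlip f -> (forall x, f x <= 1) ->
  exists g, [/\ nlip g, forall x, g x <= 1 & kernel_apply P (EFin \o f) = EFin \o g].
Proof.
move=> nf f1; have [f0 [C C0 fC]] := nf.
have fE0 y : (0 <= (EFin \o f) y)%E by rewrite lee_fin.
have mfE : measurable_fun [set: borel E] (EFin \o f).
  by apply/measurable_EFinP; exact: measurable_nlip.
have K1 x : (kernel_apply P (EFin \o f) x <= 1)%E.
  rewrite -[leRHS]/(cst 1%:E x) -(kernel_apply_cst P 1).
  by apply: (@iter_kernel_apply_le _ _ _ P 1) => // y; rewrite lee_fin.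
have K0 x : (0 <= kernel_apply P (EFin \o f) x)%E by exact: kernel_apply_ge0.
pose g x := fine (kernel_apply P (EFin \o f) x).
have gE x : kernel_apply P (EFin \o f) x = (g x)%:E.
  by rewrite fineK// ge0_fin_numE// (le_lt_trans (K1 x))// ltry.
exists g; split.
- split=> [x|]; first by rewrite -lee_fin -gE.
  exists C => // x y; rewrite -lee_fin EFinD -!gE EFinM.
  apply: le_trans (iter_lip Q_coupling 1 x y C0 nf fC) _.
  rewrite leeD2l//; apply: lee_pmul => //; first exact: coupled_dist_ge0.
- by move=> x; rewrite -lee_fin -gE.
- by apply/funext => x; rewrite gE.
Qed.

Lemma law_limit_invariant x0 (pi : probability (borel E) R) :
  (forall f, nlip f -> (forall x, f x <= 1) ->
    nlip_int (law x0 n) f @[n --> \oo] --> nlip_int pi f) ->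
  invariant_probability P pi.
Proof.
move=> pi_lim A mA.
have [m [mE mI]] := kernel_image_measure P pi.
rewrite -mE//; apply: measure_eq_nlip => //.
  rewrite [ltLHS]mE//; under eq_integral do rewrite prob_kernel.
  by rewrite integral_cst// mul1e [ltLHS]probability_setT ltry.
move=> f nf f1; have [g [ng g1 gE]] := kernel_apply_nlip nf f1.
have fE0 y : (0 <= (EFin \o f) y)%E by rewrite lee_fin; have [] := nf.
have mfE : measurable_fun [set: borel E] (EFin \o f).
  by apply/measurable_EFinP; exact: measurable_nlip.
rewrite [LHS]mI// gE.
rewrite (nlip_intE dist_le1 (probability_setT pi) nf).
rewrite [LHS](nlip_intE dist_le1 (probability_setT pi) ng); congr EFin.
have gS : (fun n => nlip_int (law x0 n) g) = (fun n => nlip_int (law x0 n.+1) f).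
  apply/funext => n; apply: EFin_inj; rewrite !nlip_int_law//.
  by rewrite iterSr gE.
have := pi_lim g ng g1; rewrite gS => /cvg_lim <-//.
apply/cvg_lim => //; rewrite (@cvg_shiftS _ (fun n => nlip_int (law x0 n) f)).
exact: pi_lim.
Qed.

(** By coupling, P^n f y has the same limit as P^n f x0 for every y, and by
    invariance the pi'-integral of P^n f does not depend on n: conclude by
    dominated convergence. *)
Lemma law_limit_unique x0 (pi pi' : probability (borel E) R) :
  (forall f, nlip f -> (forall x, f x <= 1) ->
    nlip_int (law x0 n) f @[n --> \oo] --> nlip_int pi f) ->
  invariant_probability P pi' -> forall A, measurable A -> pi' A = pi A.
Proof.
move=> pi_lim pi'_inv.
apply: measure_eq_nlip => //; first by rewrite [ltLHS]probability_setT ltry.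
move=> f nf f1; have [f0 [C C0 fC]] := nf.
have fE0 y : (0 <= (EFin \o f) y)%E by rewrite lee_fin; have [] := nf.
have mfE : measurable_fun [set: borel E] (EFin \o f).
  by apply/measurable_EFinP; exact: measurable_nlip.
pose u n := iter n (kernel_apply P) (EFin \o f).
have u0 n y : (0 <= u n y)%E by exact: iter_kernel_apply_ge0.
have mu n : measurable_fun setT (u n) by exact: measurable_iter_kernel_apply.
have u_int n : (\int[pi']_x u n x = \int[pi']_x (f x)%:E)%E.
  by elim: n => [//|n IHn]; rewrite -IHn; exact: (invariant_integral pi'_inv (u0 n) (mu n)).
have uE n y : u n y = (nlip_int (law y n) f)%:E by rewrite nlip_int_law.
have u_cvg y : u n y @[n --> \oo] --> (nlip_int pi f)%:E.
  under eq_fun do rewrite uE.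
  apply: cvg_EFin; first exact: nearW.
  apply/cvgrPdist_lt => e e0.
  have C1 : 0 < C + 1 by rewrite ltr_wpDl.
  have e2 : 0 < e / 2 / (C + 1) by rewrite !divr_gt0.
  have [N NP] := coupled_small (V x0 + V y) e2.
  have e2' : 0 < e / 2 by rewrite divr_gt0.
  have [N' _ N'P] := (cvgrPdist_lt _ _).1 (pi_lim f nf f1) _ e2'.
  exists (maxn N N') => // n /=; rewrite geq_max => /andP[Nn N'n].
  have := N'P n N'n; rewrite /=.
  have CC : C * (e / 2 / (C + 1)) <= e / 2.
    rewrite mulrA ler_pdivrMr//; nra.
  have h1 : nlip_int (law y n) f <= nlip_int (law x0 n) f + C * (e / 2 / (C + 1)).
    rewrite -lee_fin EFinD -!uE; apply: le_trans (iter_lip Q_coupling n y x0 C0 nf fC) _.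
    rewrite leeD2l// EFinM; apply: lee_pmul => //; first exact: coupled_dist_ge0.
    by apply: NP => //; rewrite addrC.
  have h2 : nlip_int (law x0 n) f <= nlip_int (law y n) f + C * (e / 2 / (C + 1)).
    rewrite -lee_fin EFinD -!uE; apply: le_trans (iter_lip Q_coupling n x0 y C0 nf fC) _.
    rewrite leeD2l// EFinM; apply: lee_pmul => //; first exact: coupled_dist_ge0.
    exact: NP.
  rewrite !ltr_norml; lra.
have [|||||_ _ +] := @dominated_convergence _ _ _ pi' setT measurableT u
    (cst (nlip_int pi f)%:E) (cst 1%E).
- exact: mu.
- exact: measurable_cst.
- by apply: aeW => y _; exact: u_cvg.
- apply/integrableP; split; first exact: measurable_cst.
  under eq_integral do rewrite /= normr1.
  by rewrite integral_cst// mul1e [ltLHS]probability_setT ltry.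
- apply: aeW => y n _ /=; rewrite gee0_abs// -[leRHS]/(cst 1%:E y).
  rewrite -(iter_kernel_apply_cst P n 1).
  by apply: iter_kernel_apply_le => // z; rewrite lee_fin.
rewrite integral_cst// [X in (_ * X)%E]probability_setT mule1.
rewrite -(nlip_intE dist_le1 (probability_setT pi) nf).
rewrite (_ : (fun n => \int[pi']_x u n x)%E = cst (\int[pi']_x (f x)%:E)%E); last first.
  by apply/funext => n; rewrite u_int.
by move=> /cvg_lim <-//; rewrite lim_cst.
Qed.

Lemma wasserstein_ergodicity :
  exists pi : probability (borel E) R,
    [/\ invariant_probability P pi,
        (forall pi' : probability (borel E) R, invariant_probability P pi' ->
          forall A : set (borel E), measurable A -> pi' A = pi A) &
        (\int[pi]_x (phi (V x))%:E < +oo)%E].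
Proof.
have [pi pi_lim] := weak_completeness dist_le1 E_separable (lawT point)
  (law_cauchy point).
have pi_inv := law_limit_invariant pi_lim.
exists pi; split => //.
- by move=> pi'; exact: (law_limit_unique pi_lim).
- apply: le_lt_trans (ltry B).
  exact: (foster_invariant VV0 mVV f_ge0 mf B_ge0 P_drift pi_inv).
Qed.

End wasserstein_ergodicity.

(** * Unique invariant probability *)

Theorem corollary2 (R : realType) (E : completeMetricType R)
  (E_separable : separable E)
  (dist_le1 : forall x y : E, mdist x y <= 1)
  (P : R.-pker (borel E) ~> (borel E))
  (Q : R.-pker (borel (E * E)%type) ~> (borel (E * E)%type))
  (Q_coupling : coupling_kernel P Q)
  (Delta : set (borel (E * E)%type)) (Delta_meas : measurable Delta)
  (l : nat) (l_ge1 : (1 <= l)%N)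
  (eps : R) (eps_gt0 : 0 < eps)
  (phi : R -> R) (phi_class : subgeometric_rate_class phi)
  (V : borel E -> R) (V_meas : measurable_fun setT V)
  (V_ge1 : forall x, 1 <= V x)
  (Q_nonexpansive : forall x y : E,
    (kernel_apply Q (fun z => (mdist z.1 z.2)%:E) (x, y)
      <= (mdist x y)%:E)%E)
  (Ql_contraction : forall x y : E, Delta (x, y) ->
    (kernel_apply (kernel_iter Q l) (fun z => (mdist z.1 z.2)%:E) (x, y)
      <= ((1 - eps) * mdist x y)%:E)%E)
  (drift : exists b : R, forall x y : E,
    (kernel_apply P (EFin \o V) x + kernel_apply P (EFin \o V) y
      <= (V x + V y - phi (V x + V y) + b * \1_Delta (x, y))%:E)%E)
  (V_Delta_bounded :
    (ereal_sup [set (V z.1 + V z.2)%:E | z in Delta] < +oo)%E) :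
  exists pi : probability (borel E) R,
    [/\ invariant_probability P pi,
        (forall pi' : probability (borel E) R, invariant_probability P pi' ->
          forall A : set (borel E), measurable A -> pi' A = pi A) &
        (\int[pi]_x (phi (V x))%:E < +oo)%E].
Proof.
(* b may be negative; the bound below needs a nonnegative constant. *)
have [b drift_b] := drift; pose B := `|b|.
have B0 : 0 <= B by exact: normr_ge0.
have bD (D : set (borel (E * E)%type)) z : b * \1_D z <= B * \1_D z.
  by rewrite ler_wpM2r ?indic_ge0// ler_norm.
have B1 (D : set (borel (E * E)%type)) z : B * \1_D z <= B.
  by rewrite ler_piMr// indicE lern1 leq_b1.
have V0 x : 0 <= V x by exact: le_trans (V_ge1 x).
have VE0 x : (0 <= (EFin \o V) x)%E by rewrite lee_fin.
have mVE : measurable_fun setT (EFin \o V) by exact/measurable_EFinP.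
(* On the diagonal the drift condition is a drift condition for P alone. *)
have P_drift x : (kernel_apply P (EFin \o (fun x => V x + V x)%R) x +
    (phi (V x))%:E <= (V x + V x + B)%:E)%E.
  have -> : kernel_apply P (EFin \o (fun x => V x + V x)%R) x =
      (kernel_apply P (EFin \o V) x + kernel_apply P (EFin \o V) x)%E.
    rewrite /kernel_apply -ge0_integralD//.
  apply: le_trans (leeD2r _ (drift_b x x)) _; rewrite -EFinD lee_fin.
  have : phi (V x) <= phi (V x + V x) by apply: rate_le => //; rewrite lerDl.
  have := bD Delta (x, x); have := B1 Delta (x, x); lra.
pose W (z : borel (E * E)%type) : R := V z.1 + V z.2.
have W_ge1 z : 1 <= W z by have := V_ge1 z.1; have := V_ge1 z.2; rewrite /W; lra.
have mV1 : measurable_fun setT (fun z : borel (E * E)%type => V z.1).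
  exact: (measurableT_comp V_meas (@measurable_fst_borel R E)).
have mV2 : measurable_fun setT (fun z : borel (E * E)%type => V z.2).
  exact: (measurableT_comp V_meas (@measurable_snd_borel R E)).
have mW : measurable_fun setT W by exact: measurable_funD.
have c0 : 0 < phi 2 by exact: rate_gt0.
have Q_drift z : (kernel_apply Q (EFin \o W) z <= (W z - phi 2 + B * \1_Delta z)%:E)%E.
  case: z => x y.
  have -> : kernel_apply Q (EFin \o W) (x, y) =
      (kernel_apply P (EFin \o V) x + kernel_apply P (EFin \o V) y)%E.
    rewrite -(coupling_fst Q_coupling x y VE0 mVE) -(coupling_snd Q_coupling x y VE0 mVE).
    rewrite /kernel_apply -ge0_integralD//.
    - exact/measurable_EFinP.
    - exact/measurable_EFinP.
  apply: le_trans (drift_b x y) _; rewrite lee_fin /W /=.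
  have : phi 2 <= phi (V x + V y).
    by apply: rate_le => //; have := V_ge1 x; have := V_ge1 y; lra.
  have := bD Delta (x, y); lra.
(* eps may exceed 1, and the powers of 1 - eps have to tend to 0. *)
pose e := Num.min eps 1.
have e0 : 0 < e by rewrite lt_min eps_gt0 ltr01.
have e1 : e <= 1 by rewrite ge_min lexx orbT.
have d0 (z : borel (E * E)%type) : 0 <= pair_dist z by exact: mdist_ge0.
have d1 (z : borel (E * E)%type) : pair_dist z <= 1 by exact: dist_le1.
have md := @measurable_pair_dist R E.
have Q_contr z : Delta z ->
    (iter l (kernel_apply Q) (EFin \o @pair_dist R E) z <= ((1 - e) * pair_dist z)%:E)%E.
  case: z => x y Dz; rewrite -kernel_apply_iter//; last exact/measurable_EFinP.
  apply: le_trans (Ql_contraction x y Dz) _.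
  rewrite lee_fin ler_wpM2r// ?mdist_ge0// lerD2l lerN2.
  by rewrite ge_min lexx.
have Q_nonexp z : (iter 1 (kernel_apply Q) (EFin \o @pair_dist R E) z <=
    (pair_dist z)%:E)%E by case: z => x y; exact: Q_nonexpansive.
apply: (wasserstein_ergodicity E_separable dist_le1 Q_coupling V_meas V_ge1
  phi_class B0 P_drift).
- move=> r M r0.
  have [m mr] : exists m, (1 - e) ^+ m < r / 2.
    have /cvgrPdist_lt/(_ (r / 2)) : (1 - e) ^+ m @[m --> \oo] --> (0 : R).
      by apply: cvg_expr; rewrite ger0_norm; lra.
    move=> /(_ ltac:(lra))[m _ /(_ m (leqnn m))] /=; rewrite sub0r normrN => h.
    by exists m; apply: le_lt_trans h; exact: ler_norm.
  have [K K0 HK] := drift_contraction d0 d1 md W_ge1 mW e1 c0 B0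
    Q_nonexp Q_contr Q_drift m.
  have r2 : 0 < r / 2 by rewrite divr_gt0.
  pose N := Num.truncn (K * `|M| / (r / 2)).
  exists N.+1 => -[//|n] Nn x y VM; apply: le_trans (HK n (x, y)) _.
  rewrite lee_fin /W /=.
  have n0 : 0 < n.+1%:R :> R by rewrite ltr0n.
  have : K * (V x + V y) / n.+1%:R <= r / 2.
    rewrite ler_pdivrMr// [leRHS]mulrC -ler_pdivrMr//.
    apply: (@le_trans _ _ (K * `|M| / (r / 2))).
      rewrite ler_pM2r ?invr_gt0// ler_wpM2l//.
      exact: le_trans VM (ler_norm M).
    apply: le_trans (ltW (truncnS_gt _)) _; rewrite ler_nat; exact: Nn.
  by move=> Wn; rewrite [leRHS]splitr lerD// ltW.
- by move=> n x y; exact: (iter_dst_le1 Q d0 d1 md).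
- exact: Q_nonexpansive.
Qed.
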